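(* Fix $L>0$ and let $\mathcal{F}_L=\{g\in C^1(\mathbb{R}^d):\kappa_g(r)\ge-r^{-1}f_L(r)\ \forall r>0\}$. Then for all $0\le t\le T<+\infty$: if $g\in\mathcal{F}_L$ then $U^{T,g}_t\in\mathcal{F}_L$.
   Context: For a differentiable $U:\mathbb{R}^d\to\mathbb{R}$ and $r>0$, $\kappa_U(r)=\inf\{|x-y|^{-2}\langle\nabla U(x)-\nabla U(y),x-y\rangle:|x-y|=r\}$. For $L>0$, $f_L(r)=2L^{1/2}\tanh(rL^{1/2}/2)$, $r\ge0$. For a function $g$ and $0\le t<T$, $U^{T,g}_t(x)=-\log\Big((2\pi(T-t))^{-d/2}\int\exp\big(-\tfrac{|y-x|^2}{2(T-t)}-g(y)\big)\mathrm{d}y\Big)$, and $U^{T,g}_T=g$; this is the solution of the HJB equation $\partial_t\varphi_t+\frac12\Delta\varphi_t-\frac12|\nabla\varphi_t|^2=0$, $\varphi_T=g$. *)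

(* Defs.v *)
From HB Require Import structures.
From mathcomp Require Import all_boot all_order all_algebra.
From mathcomp Require Import all_classical all_reals all_analysis.
Set Implicit Arguments. Unset Strict Implicit. Unset Printing Implicit Defensive.
Import Order.TTheory GRing.Theory Num.Theory.
Import numFieldNormedType.Exports.
Local Open Scope classical_set_scope.
Local Open Scope ring_scope.

Section Defs.
Variable R : realType.

(* Euclidean inner product and norm on R^d (NOT the library's sup norm). *)
Definition dotp d (u v : 'rV[R]_d) : R := \sum_(i < d) u ord0 i * v ord0 i.
Definition enorm d (u : 'rV[R]_d) : R := Num.sqrt (dotp u u).

Definition grad d (U : 'rV[R]_d -> R) (x : 'rV[R]_d) : 'rV[R]_d :=
  \row_(i < d) ('d U x (delta_mx ord0 i : 'rV[R]_d)).

Definition C1 d (U : 'rV[R]_d -> R) : Prop :=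
  (forall x, differentiable U x) /\ continuous (grad U).

Definition kappa d (U : 'rV[R]_d -> R) (r : R) : \bar R :=
  ereal_inf [set v | exists x y : 'rV[R]_d, enorm (x - y) = r /\
     v = ((enorm (x - y)) ^- 2 * dotp (grad U x - grad U y) (x - y))%:E].

Definition tanh (x : R) : R := (expR x - expR (- x)) / (expR x + expR (- x)).

Definition fL (L r : R) : R := 2 * Num.sqrt L * tanh (r * Num.sqrt L / 2).

Definition FL d (L : R) (g : 'rV[R]_d -> R) : Prop :=
  C1 g /\ forall r : R, 0 < r -> (kappa g r >= (- (r^-1 * fL L r))%:E)%E.

(* iterated Lebesgue integral over R^d (integrate out the first coordinate,
   then recurse); for nonnegative measurable integrands this is the Lebesgue
   integral over R^d by Tonelli. *)
Fixpoint iint (d : nat) : ('rV[R]_d -> \bar R) -> \bar R :=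
  match d return ('rV[R]_d -> \bar R) -> \bar R with
  | 0 => fun f => f 0
  | d'.+1 => fun f =>
      iint (fun y : 'rV[R]_d' =>
        (\int[@lebesgue_measure R]_t f (row_mx (const_mx t : 'rV[R]_1) y))%E)
  end.

Definition UTg d (T : R) (g : 'rV[R]_d -> R) (t : R) (x : 'rV[R]_d) : R :=
  if t < T then
    - ln (powR (2 * pi * (T - t)) (- (d%:R / 2)) *
          fine (iint (fun y : 'rV[R]_d =>
            (expR (- (enorm (y - x)) ^+ 2 / (2 * (T - t)) - g y))%:E)))
  else g x.

End Defs.

(* Main.v *)
Require Import Defs.
From HB Require Import structures.
From mathcomp Require Import all_boot all_order all_algebra.
From mathcomp Require Import all_classical all_reals all_analysis.
From mathcomp Require Import measurable_realfun ring lra.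
Set Implicit Arguments. Unset Strict Implicit. Unset Printing Implicit Defensive.
Import Order.TTheory GRing.Theory Num.Theory.
Import numFieldNormedType.Exports.
Local Open Scope classical_set_scope.
Local Open Scope ring_scope.

(* With a = sqrt L and psi = log cosh (a .), membership of g in F_L is equivalent to the
   derivative-free four-point inequality
     g(m+z) + g(m-z) - g(m+lz) - g(m-lz) + 2 psi(|z|) - 2 psi(l|z|) >= 0,   |l| <= 1,
   because f_L(2p) = 2 psi'(p).  For U = - log u, with u the heat flow of exp(-g), this
   inequality is propagated by a maximum principle.  At a negative interior minimum over
   (s, m, z, l), the first-order conditions give the gradients of U at the four points up to
   a part orthogonal to z of favourable sign, and the second-order condition along
   displacements coupled by reflection in the hyperplane orthogonal to z controls the
   Laplacians; since psi'' + (psi')^2 = a^2 is constant, the time derivative is nonnegative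
   there, a contradiction.  Multiplying exp(-g) by exp(-eps|y|^2) and adding delta to u at
   the inner points makes the minimum exist; then eps, delta -> 0.  All the analysis of the
   heat flow reduces to pointwise inequalities, since the iterated integral is a positive
   linear functional on continuous functions with Gaussian decay. *)

(** * Euclidean structure *)

(** The profile comes from an explicit solution: in dimension one, exp(a^2 s / 2) cosh(a x) solves
    the heat equation, and minus its logarithm gives equality in the four-point inequality at m = 0.
    The obstacle is that [g] is only C1. A maximum principle for the two-point gradient inequality
    would need third derivatives of [u] and control of gradients as s -> 0. The four-point form
    involves values only: continuity of the flow up to s = 0 suffices at the initial time, and its
    second variation stops at second derivatives. The variable l lets the outer radius |z| and the
    inner radius l|z| vary independently, so the first-order conditions at the outer and inner
    points separate. Under the reflection coupling the difference of the two displacements is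
    parallel to z; hence |z| changes exactly linearly and the norm contributes no second-order
    error. *)

Section DotProduct.
Variables (R : realType) (d : nat).
Implicit Types (x y z : 'rV[R]_d) (k : R).

Lemma dotpC x y : dotp x y = dotp y x.
Proof. by apply: eq_bigr => i _; rewrite mulrC. Qed.

Lemma dotpDl x y z : dotp (x + y) z = dotp x z + dotp y z.
Proof. by rewrite -big_split; apply: eq_bigr => i _; rewrite mxE mulrDl. Qed.

Lemma dotpDr x y z : dotp x (y + z) = dotp x y + dotp x z.
Proof. by rewrite dotpC dotpDl !(dotpC x). Qed.

Lemma dotpZl k x y : dotp (k *: x) y = k * dotp x y.
Proof. by rewrite mulr_sumr; apply: eq_bigr => i _; rewrite mxE mulrA. Qed.

Lemma dotpZr k x y : dotp x (k *: y) = k * dotp x y.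
Proof. by rewrite dotpC dotpZl dotpC. Qed.

Lemma dotpNl x y : dotp (- x) y = - dotp x y.
Proof. by rewrite -scaleN1r dotpZl mulN1r. Qed.

Lemma dotpNr x y : dotp x (- y) = - dotp x y.
Proof. by rewrite dotpC dotpNl dotpC. Qed.

Lemma dotpBl x y z : dotp (x - y) z = dotp x z - dotp y z.
Proof. by rewrite dotpDl dotpNl. Qed.

Lemma dotpBr x y z : dotp x (y - z) = dotp x y - dotp x z.
Proof. by rewrite dotpDr dotpNr. Qed.

Lemma dotp0l x : dotp 0 x = 0.
Proof. by rewrite /dotp big1// => i _; rewrite mxE mul0r. Qed.

Lemma dotp0r x : dotp x 0 = 0.
Proof. by rewrite dotpC dotp0l. Qed.

Definition dotpE := (dotpDl, dotpDr, dotpNl, dotpNr, dotpZl, dotpZr).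

Lemma dotpp_ge0 x : 0 <= dotp x x.
Proof. by apply: sumr_ge0 => i _; rewrite -expr2 sqr_ge0. Qed.

Lemma dotpp_eq0 x : dotp x x = 0 -> x = 0.
Proof.
move=> /eqP; rewrite psumr_eq0; last by move=> i _; rewrite -expr2 sqr_ge0.
move=> /allP h; apply/rowP => i; rewrite mxE.
by have := h i; rewrite mem_index_enum => /(_ isT)/=; rewrite -expr2 sqrf_eq0 => /eqP.
Qed.

Lemma sqr_coord_le x i : (x ord0 i) ^+ 2 <= dotp x x.
Proof.
rewrite /dotp (bigD1 i)//= -expr2 lerDl.
by apply: sumr_ge0 => j _; rewrite -expr2 sqr_ge0.
Qed.

Lemma dotp_delta x i : dotp x (delta_mx ord0 i) = x ord0 i.
Proof.
rewrite /dotp (bigD1 i)//= mxE !eqxx mulr1 big1 ?addr0// => j ji.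
by rewrite mxE eqxx (negbTE ji) mulr0.
Qed.

Lemma dotp_young c x y : 0 < c -> dotp x y <= c * dotp y y + (4 * c)^-1 * dotp x x.
Proof.
move=> c0; have := dotpp_ge0 ((2 * c) *: y - x).
rewrite !dotpE (dotpC y x) => h.
have c4 : 0 < 4 * c by rewrite mulr_gt0.
rewrite -(ler_pM2l c4) mulrDr mulVKf ?gt_eqF//; lra.
Qed.

Lemma enorm_ge0 x : 0 <= enorm x.
Proof. exact: sqrtr_ge0. Qed.

Lemma sqr_enorm x : enorm x ^+ 2 = dotp x x.
Proof. by rewrite sqr_sqrtr ?dotpp_ge0. Qed.

Lemma enormZ k x : enorm (k *: x) = `|k| * enorm x.
Proof. by rewrite /enorm !dotpE mulrA -expr2 sqrtrM ?sqr_ge0// sqrtr_sqr. Qed.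

Lemma enorm_eq0 x : enorm x = 0 -> x = 0.
Proof. by move=> h; apply: dotpp_eq0; rewrite -sqr_enorm h expr0n. Qed.

End DotProduct.

Section DotProductTopology.
Variables (R : realType) (d : nat).
Implicit Types (x y z : 'rV[R]_d).

(** The topology of row vectors is that of the sup norm |x|, so topological statements pass through
    its comparison with [dotp x x]. *)
Lemma coord_le_norm x i : `|x ord0 i| <= `|x|.
Proof.
rewrite [leRHS]/Num.Def.normr/= mx_normrE.
by apply/bigmax_geP; right => /=; exists (ord0, i).
Qed.

Lemma dotpp_le_norm x : dotp x x <= d%:R * `|x| ^+ 2.
Proof.
apply: (@le_trans _ _ (\sum_(i < d) `|x| ^+ 2)).
  apply: ler_sum => i _; rewrite -expr2 -real_normK ?num_real//.
  by rewrite ler_sqr ?nnegrE// coord_le_norm.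
by rewrite sumr_const card_ord mulr_natl.
Qed.

Lemma norm_sqr_le_dotpp x : `|x| ^+ 2 <= dotp x x.
Proof.
have [->|] := eqVneq x 0; first by rewrite normr0 expr0n dotp0l.
rewrite -normr_eq0 => /mx_norm_neq0[[i j] /= hij].
rewrite [`|x|]hij (ord1 i) real_normK ?num_real//.
exact: sqr_coord_le.
Qed.

Lemma continuous_dotp (T : topologicalType) (f g : T -> 'rV[R]_d) (t : T) :
  {for t, continuous f} -> {for t, continuous g} ->
  {for t, continuous (fun s => dotp (f s) (g s))}.
Proof.
move=> cf cg; apply: cvg_big => [|i _]; first exact: add_continuous.
apply: cvgM.
  by apply: (@cvg_comp _ _ _ f (fun v : 'rV[R]_d => v ord0 i) _ _ _ cf);
    exact: coord_continuous.
by apply: (@cvg_comp _ _ _ g (fun v : 'rV[R]_d => v ord0 i) _ _ _ cg);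
  exact: coord_continuous.
Qed.

Lemma continuous_enorm : continuous (@enorm R d).
Proof.
move=> x; apply: (@cvg_comp _ _ _ (fun y => dotp y y) Num.sqrt).
  by apply: (@continuous_dotp _ (fun y => y) (fun y => y) x); exact: cvg_id.
exact: sqrt_continuous.
Qed.

End DotProductTopology.

Section ContinuousReal.
Variables (R : realType) (T : topologicalType).
Implicit Types f g : T -> R.

Lemma continuous_add f g : continuous f -> continuous g ->
  continuous (fun t => f t + g t).
Proof. by move=> cf cg t; apply: cvgD; [exact: cf|exact: cg]. Qed.

Lemma continuous_mul f g : continuous f -> continuous g ->
  continuous (fun t => f t * g t).
Proof. by move=> cf cg t; apply: cvgM; [exact: cf|exact: cg]. Qed.

Lemma continuous_cst (k : R) : continuous (fun _ : T => k).
Proof. by move=> t; exact: cvg_cst. Qed.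

Lemma continuous_opp f : continuous f -> continuous (fun t => - f t).
Proof. by move=> cf t; apply: cvgN; exact: cf. Qed.

Lemma continuous_comp_real (k : R -> R) f : continuous k -> continuous f ->
  continuous (fun t => k (f t)).
Proof. by move=> ck cf t; apply: (@cvg_comp _ _ _ f k _ (nbhs (f t)) _ (cf t)); exact: ck. Qed.

Lemma continuous_ln_comp f : (forall t, 0 < f t) -> continuous f ->
  continuous (fun t => ln (f t)).
Proof.
move=> f0 cf t; apply: (@cvg_comp _ _ _ f (@ln R) _ (nbhs (f t)) _ (cf t)).
exact: continuous_ln.
Qed.

End ContinuousReal.

(** * The iterated integral on functions with Gaussian decay *)

Section Integral.
Variable R : realType.
Notation mu := (@lebesgue_measure R).

(** Dominated convergence speaks of sequences; this turns it into continuity of a parameter integral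
    in [gdec_slice]. If convergence fails, choosing bad points at distance below 1/(n+1) gives a
    sequence that violates the hypothesis. *)
Lemma cvg_seqP_rV d (f : 'rV[R]_d -> R) (p : 'rV[R]_d) (l : R) :
  (forall u : nat -> 'rV[R]_d, u n @[n --> \oo] --> p -> f (u n) @[n --> \oo] --> l) ->
  f x @[x --> p] --> l.
Proof.
move=> H; apply: contrapT => nf.
have [e e0 He] : exists2 e : R, 0 < e & forall n : nat, exists x, `|p - x| < n.+1%:R^-1 /\ e <= `|l - f x|.
  apply: contrapT => h; apply: nf.
  apply/(@cvgrPdist_lt _ _ _ (nbhs p) _ f l) => e e0.
  apply: contrapT => hn; apply: h; exists e => // n.
  apply: contrapT => hx; apply: hn.
  apply/nbhs_ballP; exists n.+1%:R^-1 => /=; first by rewrite invr_gt0.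
  move=> x; rewrite -ball_normE /= => px.
  by rewrite ltNge; apply/negP => ?; apply: hx; exists x.
have [u Hu] := choice He.
have up : u n @[n --> \oo] --> p.
  apply/cvgrPdist_lt => r r0.
  have := @cvg_harmonic R; move/cvgrPdist_lt => /(_ _ r0).
  apply: filterS => n; rewrite sub0r normrN /= => h.
  by have [h1 _] := Hu n; apply: lt_trans h1 _; rewrite (le_lt_trans _ h)// ler_norm.
have /cvgrPdist_lt/(_ _ e0)[N _ /(_ N (leqnn N))] := H u up.
by have [_] := Hu N; rewrite leNgt => /negP.
Qed.

(** Passing to the normal density of variance 1/(2c) imports its integrability and its total
    mass. *)
Lemma gauss_scalarE (c m t : R) : 0 < c ->
  expR (- c * (t - m) ^+ 2) =
  Num.sqrt (pi / c) * normal_pdf m (Num.sqrt (2 * c)^-1) t.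
Proof.
move=> c0; set s := Num.sqrt (2 * c)^-1.
have s2 : s ^+ 2 = (2 * c)^-1.
  by rewrite sqr_sqrtr// invr_ge0 mulr_ge0// ltW.
have s0 : s != 0 by rewrite gt_eqF// sqrtr_gt0 invr_gt0 mulr_gt0.
have pk : normal_peak s = (Num.sqrt (pi / c))^-1.
  rewrite /normal_peak s2; congr (Num.sqrt _)^-1.
  by rewrite -mulr_natr; field; rewrite gt_eqF.
rewrite normal_pdfE// pk mulVKf; last by rewrite gt_eqF// sqrtr_gt0 divr_gt0// pi_gt0.
rewrite /normal_fun s2; congr expR; rewrite -mulr_natr; field.
by rewrite gt_eqF.
Qed.

Lemma integrable_gauss (c m : R) : 0 < c ->
  mu.-integrable setT (EFin \o (fun t => expR (- c * (t - m) ^+ 2))).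
Proof.
move=> c0; rewrite (_ : _ \o _ = fun t => ((Num.sqrt (pi / c))%:E * (normal_pdf m (Num.sqrt (2 * c)^-1) t)%:E)%E).
  by apply: integrableZl => //; exact: integrable_normal_pdf.
by apply/funext => t /=; rewrite gauss_scalarE// EFinM.
Qed.

Lemma Rintegral_gauss (c m : R) : 0 < c ->
  (\int[mu]_t expR (- c * (t - m) ^+ 2))%R = Num.sqrt (pi / c).
Proof.
move=> c0; rewrite /Rintegral.
under eq_integral do rewrite gauss_scalarE// EFinM.
rewrite integralZl//; last exact: integrable_normal_pdf.
by rewrite integral_normal_pdf mule1.
Qed.

(** Coordinates are split exactly as in [iint], at the index [1 + d], which is convertible to
    [d.+1]. *)
Definition consr d (t : R) (y : 'rV[R]_d) : 'rV[R]_(1 + d) :=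
  row_mx (const_mx t : 'rV[R]_1) y.

Lemma dotp_consr d (t s : R) (y z : 'rV[R]_d) :
  dotp (consr t y) (consr s z) = t * s + dotp y z.
Proof.
rewrite /dotp big_split_ord/= big_ord1 !row_mxEl !mxE; congr (_ + _).
by apply: eq_bigr => i _; rewrite !row_mxEr.
Qed.

Lemma consr_split d (x : 'rV[R]_(1 + d)) : consr (x ord0 ord0) (rsubmx x) = x.
Proof.
rewrite /consr -[RHS]hsubmxK; congr row_mx; apply/rowP => i.
by rewrite !mxE; congr (x _ _); apply/val_inj; rewrite /= ord1.
Qed.

Lemma norm_consr_le d (t : R) (y : 'rV[R]_d) : `|consr t y| <= `|t| + `|y|.
Proof.
rewrite [leLHS]/Num.Def.normr/= mx_normrE; apply/bigmax_leP; split=> [|[i j] _ /=].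
  by rewrite addr_ge0.
rewrite (ord1 i) /consr mxE; case: splitP => k _.
  by rewrite mxE lerDl.
by apply: le_trans (coord_le_norm _ _) _; rewrite lerDr.
Qed.

Lemma consrB d t s (y z : 'rV[R]_d) : consr t y - consr s z = consr (t - s) (y - z).
Proof.
by rewrite /consr opp_row_mx add_row_mx; congr row_mx; apply/rowP => i; rewrite !mxE.
Qed.

Lemma consr_continuousl d (y : 'rV[R]_d) : continuous (fun t => consr t y).
Proof.
move=> t; apply/cvgrPdist_lt => e e0; near=> s.
rewrite consrB subrr; apply: le_lt_trans (norm_consr_le _ _) _.
rewrite normr0 addr0; near: s; exact: cvgr_dist_lt.
Unshelve. all: end_near. Qed.

Lemma consr_continuousr d (t : R) : continuous (@consr d t).
Proof.
move=> y; apply/(@cvgrPdist_lt _ _ _ (nbhs y)) => e e0; near=> s.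
rewrite consrB subrr; apply: le_lt_trans (norm_consr_le _ _) _.
rewrite normr0 add0r; near: s; exact: cvgr_dist_lt.
Unshelve. all: end_near. Qed.

(* On [gdec] functions the iterated integral is a positive linear functional, and
   [gdec] is stable under integrating out the first coordinate. *)
Definition gdec d (f : 'rV[R]_d -> R) : Prop :=
  continuous f /\
  exists C c : R, [/\ 0 <= C, 0 < c & forall y, `|f y| <= C * expR (- c * dotp y y)].

Lemma measurable_continuous_consr d (f : 'rV[R]_(1 + d) -> R) y : continuous f ->
  measurable_fun setT (fun t => f (consr t y)).
Proof.
move=> cf; apply: measurable_realfun.continuous_measurable_fun => t.
by apply: (@cvg_comp _ _ _ (fun t => consr t y) f); [exact: consr_continuousl|exact: cf].
Qed.

Lemma gdec_integrable d (f : 'rV[R]_(1 + d) -> R) y : gdec f ->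
  mu.-integrable setT (EFin \o (fun t => f (consr t y))).
Proof.
move=> [cf [C [c [C0 c0 fC]]]].
have ig := integrable_gauss 0 c0.
apply: (@le_integrable _ _ _ mu setT _ _ (EFin \o (fun t => C * expR (- c * (t - 0) ^+ 2)))) => //=.
- by apply/measurable_EFinP; exact: measurable_continuous_consr.
- move=> t _; rewrite lee_fin; apply: le_trans (fC _) _.
  rewrite dotp_consr subr0 ger0_norm ?mulr_ge0 ?expR_ge0//.
  rewrite ler_wpM2l// ler_expR -expr2.
  by rewrite mulrDr gerDl mulNr oppr_le0 mulr_ge0 ?dotpp_ge0// ltW.
rewrite (_ : _ \o _ = fun t => (C%:E * (EFin \o (fun t => expR (- c * (t - 0) ^+ 2))) t)%E).
  exact: integrableZl.
by apply/funext => t /=; rewrite EFinM.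
Qed.

Definition slice d (f : 'rV[R]_(1 + d) -> R) (y : 'rV[R]_d) : R :=
  (\int[mu]_t f (consr t y))%R.

Lemma EFin_slice d (f : 'rV[R]_(1 + d) -> R) y : gdec f ->
  (slice f y)%:E = (\int[mu]_t (f (consr t y))%:E)%E.
Proof.
move=> /gdec_integrable => /(_ y) h; rewrite /slice /Rintegral fineK//.
exact: integrable_fin_num.
Qed.

Lemma gdec_slice d (f : 'rV[R]_(1 + d) -> R) : gdec f -> gdec (slice f).
Proof.
move=> gf; have [cf [C [c [C0 c0 fC]]]] := gf; split; last first.
  exists (C * Num.sqrt (pi / c)), c; split => //.
    by rewrite mulr_ge0 ?sqrtr_ge0.
  move=> y; rewrite /slice.
  apply: le_trans (le_normr_Rintegral _ (gdec_integrable y gf)) _ => //.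
  have ig := integrable_gauss 0 c0.
  (* The Gaussian bound factorises: the factor in [t] integrates to sqrt(pi / c), the factor in [y]
     keeps the rate [c]. *)
  have e t : C * expR (- c * dotp y y) * expR (- c * (t - 0) ^+ 2) =
     C * expR (- c * dotp (consr t y) (consr t y)).
    rewrite dotp_consr mulrDr expRD -[in LHS]mulrA; congr (_ * _).
    by rewrite mulrC subr0 expr2.
  apply: le_trans (_ : (\int[mu]_t (C * expR (- c * dotp y y) * expR (- c * (t - 0) ^+ 2)))%R <= _).
    apply: le_Rintegral => //.
    - have := integrable_norm (gdec_integrable y gf).
      by [].
    - rewrite (_ : _ \o _ = fun t => ((C * expR (- c * dotp y y))%:E * (EFin \o (fun t => expR (- c * (t - 0) ^+ 2))) t)%E).
        exact: integrableZl.
      by apply/funext => t /=; rewrite EFinM.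
    - by move=> t _; rewrite e.
  rewrite RintegralZl// Rintegral_gauss//.
  by rewrite -!mulrA ler_wpM2l// mulrC.
(* Dropping |y|^2 from the exponent leaves a Gaussian in [t] alone, which dominates uniformly along
   the sequence. *)
move=> y; apply: cvg_seqP_rV => u uy.
rewrite /slice /Rintegral; apply: fine_cvg.
rewrite fineK; last exact: (integrable_fin_num _ (gdec_integrable y gf)).
apply: (@dominated_cvg _ _ _ mu setT measurableT (fun n t => (f (consr t (u n)))%:E) _
   (EFin \o (fun t => C * expR (- c * (t - 0) ^+ 2)))) => //=.
- by move=> n; apply/measurable_EFinP; exact: measurable_continuous_consr.
- move=> t _; apply: cvg_EFin; first exact: nearW.
  apply: (@cvg_comp _ _ _ u (fun z => f (consr t z)) _ (nbhs y) _ uy).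
  by apply: (@cvg_comp _ _ _ (consr t) f); [exact: consr_continuousr|exact: cf].
- rewrite (_ : _ \o _ = fun t => (C%:E * (EFin \o (fun t => expR (- c * (t - 0) ^+ 2))) t)%E).
    by apply: integrableZl => //; exact: integrable_gauss.
  by apply/funext => t /=; rewrite EFinM.
- move=> n t _; rewrite lee_fin; apply: le_trans (fC _) _.
  rewrite dotp_consr subr0 ler_wpM2l// ler_expR -expr2.
  by rewrite mulrDr gerDl mulNr oppr_le0 mulr_ge0 ?dotpp_ge0// ltW.
Qed.

Lemma eq_iint d (f g : 'rV[R]_d -> \bar R) : f =1 g -> iint f = iint g.
Proof. by move=> /funext ->. Qed.

(** Real-valued twin of [iint]: on [gdec] functions every partial integral is finite, so linearity
    and order need no extended reals. *)
Fixpoint Riint (d : nat) : ('rV[R]_d -> R) -> R :=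
  match d return ('rV[R]_d -> R) -> R with
  | 0 => fun f => f 0
  | d'.+1 => fun f => Riint (@slice d' f)
  end.

Lemma EFin_Riint d (f : 'rV[R]_d -> R) : gdec f ->
  iint (fun y => (f y)%:E) = (Riint f)%:E.
Proof.
elim: d f => [//|d ih] f gf /=.
rewrite -ih; last exact: gdec_slice.
by apply: eq_iint => y; rewrite (EFin_slice _ gf).
Qed.

End Integral.

Section GaussianDecay.
Variable R : realType.
Notation mu := (@lebesgue_measure R).

Lemma gdec_le d (f g : 'rV[R]_d -> R) : continuous f ->
  (forall y, `|f y| <= g y) -> gdec g -> gdec f.
Proof.
move=> cf fg [_ [C [c [C0 c0 gC]]]]; split => //; exists C, c; split => // y.
by apply: le_trans (fg y) _; apply: le_trans (gC y); exact: ler_norm.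
Qed.

Lemma gdecD d (f g : 'rV[R]_d -> R) : gdec f -> gdec g -> gdec (fun y => f y + g y).
Proof.
move=> [cf [C [c [C0 c0 fC]]]] [cg [D [e [D0 e0 gD]]]]; split.
  exact: continuous_add.
exists (C + D), (Num.min c e); split; first exact: addr_ge0.
  by rewrite lt_min c0.
move=> y; apply: le_trans (ler_normD _ _) _; rewrite mulrDl.
have yy := dotpp_ge0 y.
apply: lerD; [apply: le_trans (fC y) _|apply: le_trans (gD y) _];
  rewrite ler_wpM2l// ler_expR !mulNr lerN2 ler_wpM2r// ge_min lexx ?orbT//.
Qed.

Lemma gdecZ d k (f : 'rV[R]_d -> R) : gdec f -> gdec (fun y => k * f y).
Proof.
move=> [cf [C [c [C0 c0 fC]]]]; split.
  by apply: continuous_mul => //; exact: continuous_cst.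
exists (`|k| * C), c; split => // [|y]; first exact: mulr_ge0.
by rewrite normrM -mulrA ler_wpM2l.
Qed.

Lemma gdecB d (f g : 'rV[R]_d -> R) : gdec f -> gdec g -> gdec (fun y => f y - g y).
Proof.
move=> gf gg; have := gdecD gf (gdecZ (-1) gg).
by congr gdec; apply/funext => y; rewrite mulN1r.
Qed.

Lemma gdec_norm d (f : 'rV[R]_d -> R) : gdec f -> gdec (fun y => `|f y|).
Proof.
move=> [cf [C [c [C0 c0 fC]]]]; split; last first.
  by exists C, c; split => // y; rewrite normr_id.
by apply: continuous_comp_real => //; exact: norm_continuous.
Qed.

Lemma gdec0 d : gdec (fun _ : 'rV[R]_d => 0).
Proof.
split; first exact: continuous_cst.
by exists 0, 1; split => // y; rewrite normr0 mul0r.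
Qed.

Lemma gdec_sum d n (f : 'I_n -> 'rV[R]_d -> R) : (forall i, gdec (f i)) ->
  gdec (fun y => \sum_(i < n) f i y).
Proof.
elim: n f => [|n ih] f gf.
  by rewrite (_ : (fun y => _) = fun=> 0); [exact: gdec0|apply/funext => y; rewrite big_ord0].
rewrite (_ : (fun y => _) = fun y => f ord0 y + \sum_(i < n) f (lift ord0 i) y).
  by apply: gdecD => //; exact: ih.
by apply/funext => y; rewrite big_ord_recl.
Qed.

Lemma sliceD d (f g : 'rV[R]_(1 + d) -> R) : gdec f -> gdec g ->
  slice (fun y => f y + g y) = fun y => slice f y + slice g y.
Proof.
move=> gf gg; apply/funext => y; rewrite /slice RintegralD//;
  exact: gdec_integrable.
Qed.

Lemma sliceZ d k (f : 'rV[R]_(1 + d) -> R) : gdec f ->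
  slice (fun y => k * f y) = fun y => k * slice f y.
Proof.
move=> gf; apply/funext => y; rewrite /slice RintegralZl//; exact: gdec_integrable.
Qed.

Lemma slice_le d (f g : 'rV[R]_(1 + d) -> R) : gdec f -> gdec g ->
  (forall y, f y <= g y) -> forall y, slice f y <= slice g y.
Proof. by move=> gf gg fg y; apply: le_Rintegral => //; exact: gdec_integrable. Qed.

(** If the integral vanished, the integrand would vanish almost everywhere and the whole line would
    be a null set; the unit interval refutes this. *)
Lemma slice_gt0 d (f : 'rV[R]_(1 + d) -> R) : gdec f ->
  (forall y, 0 < f y) -> forall y, 0 < slice f y.
Proof.
move=> gf f0 y; rewrite lt_neqAle; apply/andP; split; last first.
  by apply: Rintegral_ge0 => t _; exact: ltW.
apply/eqP => h.
have hi := gdec_integrable y gf.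
have h0 : (\int[mu]_t `|(f (consr t y))%:E|)%E = 0%E.
  under eq_integral do rewrite gee0_abs ?lee_fin ?(ltW (f0 _))//.
  by rewrite -EFin_slice// -h.
have mf : measurable_fun setT (EFin \o (fun t => f (consr t y))) by case/integrableP: hi.
have [N [mN N0 sN]] := (ae_eq_integral_abs mu measurableT mf).1 h0.
have : (mu setT <= mu N)%E.
  apply: le_measure; rewrite ?inE// => t _; apply: sN => /= ht.
  have [] := ht I; move=> /eqP; rewrite gt_eqF//.
rewrite N0 measure_le0 => /eqP.
have : (mu `[0%R, 1%R]%classic <= mu setT)%E by apply: le_measure; rewrite ?inE.
by move=> /[swap] ->; rewrite lebesgue_measure_itv/= lte01 oppr0 adde0 lee_fin ler10.
Qed.

Lemma RiintD d (f g : 'rV[R]_d -> R) : gdec f -> gdec g ->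
  Riint (fun y => f y + g y) = Riint f + Riint g.
Proof.
elim: d f g => [//|d ih] f g gf gg /=.
rewrite -ih; [|exact: gdec_slice|exact: gdec_slice].
by congr Riint; exact: sliceD.
Qed.

Lemma RiintZ d k (f : 'rV[R]_d -> R) : gdec f ->
  Riint (fun y => k * f y) = k * Riint f.
Proof.
elim: d f => [//|d ih] f gf /=.
rewrite -ih; last exact: gdec_slice.
by congr Riint; exact: sliceZ.
Qed.

Lemma RiintB d (f g : 'rV[R]_d -> R) : gdec f -> gdec g ->
  Riint (fun y => f y - g y) = Riint f - Riint g.
Proof.
move=> gf gg; rewrite -[- Riint g]mulN1r -RiintZ// -RiintD//; last exact: gdecZ.
by congr Riint; apply/funext => y; rewrite mulN1r.
Qed.

Lemma le_Riint d (f g : 'rV[R]_d -> R) : gdec f -> gdec g ->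
  (forall y, f y <= g y) -> Riint f <= Riint g.
Proof.
elim: d f g => [|d ih] f g gf gg fg /=; first exact: fg.
by apply: ih; [exact: gdec_slice|exact: gdec_slice|exact: slice_le].
Qed.

Lemma Riint_gt0 d (f : 'rV[R]_d -> R) : gdec f ->
  (forall y, 0 < f y) -> 0 < Riint f.
Proof.
elim: d f => [|d ih] f gf f0 /=; first exact: f0.
by apply: ih; [exact: gdec_slice|exact: slice_gt0].
Qed.

Lemma Riint0 d : Riint (fun _ : 'rV[R]_d => 0) = 0.
Proof.
by have := RiintZ 0 (@gdec0 d); rewrite !mul0r.
Qed.

Lemma Riint_ge0 d (f : 'rV[R]_d -> R) : gdec f ->
  (forall y, 0 <= f y) -> 0 <= Riint f.
Proof. by move=> gf f0; rewrite -(@Riint0 d); apply: le_Riint => //; exact: gdec0. Qed.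

Lemma Riint_sum d n (f : 'I_n -> 'rV[R]_d -> R) : (forall i, gdec (f i)) ->
  Riint (fun y => \sum_(i < n) f i y) = \sum_(i < n) Riint (f i).
Proof.
elim: n f => [|n ih] f gf.
  rewrite big_ord0 -[RHS](@Riint0 d); congr Riint.
  by apply/funext => y; rewrite big_ord0.
rewrite big_ord_recl -ih// -RiintD//; last by apply: gdec_sum.
by congr Riint; apply/funext => y; rewrite big_ord_recl.
Qed.

Lemma norm_Riint_le d (f g : 'rV[R]_d -> R) : gdec f -> gdec g ->
  (forall y, `|f y| <= g y) -> `|Riint f| <= Riint g.
Proof.
move=> gf gg fg; rewrite ler_norml; apply/andP; split.
  rewrite -mulN1r -RiintZ//; apply: le_Riint => //; first exact: gdecZ.
  by move=> y; rewrite mulN1r; have := fg y; rewrite ler_norml => /andP[].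
by apply: le_Riint => // y; have := fg y; rewrite ler_norml => /andP[].
Qed.

(* The multipliers of [gdec]. *)
Definition sgrow d (k : 'rV[R]_d -> R) : Prop :=
  continuous k /\
  forall c : R, 0 < c -> exists2 C : R, 0 <= C & forall y, `|k y| <= C * expR (c * dotp y y).

Lemma sgrowD d (f g : 'rV[R]_d -> R) : sgrow f -> sgrow g -> sgrow (fun y => f y + g y).
Proof.
move=> [cf fC] [cg gC]; split.
  exact: continuous_add.
move=> c c0; have [C C0 hC] := fC c c0; have [D D0 hD] := gC c c0.
exists (C + D); first exact: addr_ge0.
move=> y; apply: le_trans (ler_normD _ _) _; rewrite mulrDl.
exact: lerD.
Qed.

Lemma sgrowM d (f g : 'rV[R]_d -> R) : sgrow f -> sgrow g -> sgrow (fun y => f y * g y).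
Proof.
move=> [cf fC] [cg gC]; split.
  exact: continuous_mul.
move=> c c0; have c2 : 0 < c / 2 by rewrite divr_gt0.
have [C C0 hC] := fC _ c2; have [D D0 hD] := gC _ c2.
exists (C * D); first exact: mulr_ge0.
move=> y; rewrite normrM; apply: le_trans (ler_pM _ _ (hC y) (hD y)) _ => //.
by rewrite mulrACA -expRD -mulrDl -splitr.
Qed.

Lemma sgrow_cst d k : sgrow (fun _ : 'rV[R]_d => k).
Proof.
split; first exact: continuous_cst.
move=> c c0; exists `|k| => // y.
by rewrite ler_peMr// -expR0 ler_expR mulr_ge0 ?dotpp_ge0// ltW.
Qed.

Lemma sgrowZ d k (f : 'rV[R]_d -> R) : sgrow f -> sgrow (fun y => k * f y).
Proof. by move=> sf; apply: sgrowM => //; exact: sgrow_cst. Qed.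

Lemma sgrowX d n (f : 'rV[R]_d -> R) : sgrow f -> sgrow (fun y => f y ^+ n).
Proof.
move=> sf; elim: n => [|n ih]; first exact: sgrow_cst.
rewrite (_ : (fun y => _) = fun y => f y * f y ^+ n); first exact: sgrowM.
by apply/funext => y; rewrite exprS.
Qed.

Lemma sgrow_dotpr d v : sgrow (fun y : 'rV[R]_d => dotp v y).
Proof.
split.
  by move=> y; apply: (@continuous_dotp _ _ _ (fun=> v) (fun y => y) y); [exact: cst_continuous|exact: cvg_id].
move=> c c0; exists (1 + (4 * c)^-1 * dotp v v).
  by rewrite addr_ge0// mulr_ge0 ?dotpp_ge0// invr_ge0 mulr_ge0// ltW.
move=> y.
have [v0 y0] := (dotpp_ge0 v, dotpp_ge0 y).
have i0 : 0 <= (4 * c)^-1 by rewrite invr_ge0 mulr_ge0// ltW.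
have h : `|dotp v y| <= c * dotp y y + (4 * c)^-1 * dotp v v.
  rewrite ler_norml dotp_young// andbT lerNl -dotpNr.
  by have := dotp_young v (- y) c0; rewrite [dotp (- y) (- y)]dotpNl (dotpNr y) opprK.
apply: le_trans h _.
have e1 : 1 + c * dotp y y <= expR (c * dotp y y) by rewrite expR_ge1Dx.
have e2 : 1 <= expR (c * dotp y y).
  by rewrite -expR0 ler_expR mulr_ge0// ltW.
have m0 : 0 <= (4 * c)^-1 * dotp v v by rewrite mulr_ge0.
move: m0; set M := (4 * c)^-1 * _ => m0.
have := mulr_ge0 m0 (_ : 0 <= expR (c * dotp y y) - 1); rewrite subr_ge0 => /(_ e2).
rewrite mulrBr mulr1 subr_ge0 => h.
by rewrite [X in _ <= X]mulrDl mul1r; apply: lerD => //; lra.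
Qed.

Lemma sgrow_dotpp d : sgrow (fun y : 'rV[R]_d => dotp y y).
Proof.
split; first by move=> y; apply: (@continuous_dotp _ _ _ (fun y => y) (fun y => y) y); exact: cvg_id.
move=> c c0; exists c^-1; first by rewrite invr_ge0 ltW.
move=> y; rewrite ger0_norm ?dotpp_ge0// ler_pdivlMl//.
by apply: le_trans (expR_ge1Dx _); rewrite lerDr.
Qed.

Lemma sgrow_dotppB d x : sgrow (fun y : 'rV[R]_d => dotp (y - x) (y - x)).
Proof.
rewrite (_ : (fun y => _) = fun y => (dotp y y + dotp ((-2) *: x) y) + dotp x x).
  apply: sgrowD; last exact: sgrow_cst.
  by apply: sgrowD; [exact: sgrow_dotpp|exact: sgrow_dotpr].
by apply/funext => y; rewrite !dotpE (dotpC y x); ring.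
Qed.

Lemma sgrow_dotpB d x v : sgrow (fun y : 'rV[R]_d => dotp (y - x) v).
Proof.
rewrite (_ : (fun y => _) = fun y => dotp v y + (- dotp x v)).
  by apply: sgrowD; [exact: sgrow_dotpr|exact: sgrow_cst].
by apply/funext => y; rewrite !dotpE (dotpC y v).
Qed.

Lemma sgrow_exp_dotp d v : sgrow (fun y : 'rV[R]_d => expR (dotp v y)).
Proof.
split; first by apply: (continuous_comp_real (@continuous_expR R)); have [] := sgrow_dotpr v.
move=> c c0; exists (expR ((4 * c)^-1 * dotp v v)); first exact: expR_ge0.
move=> y; rewrite ger0_norm ?expR_ge0// -expRD ler_expR addrC.
exact: dotp_young.
Qed.

Lemma gdecM d (k f : 'rV[R]_d -> R) : sgrow k -> gdec f -> gdec (fun y => k y * f y).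
Proof.
move=> [ck kC] [cf [D [c [D0 c0 fD]]]]; split.
  exact: continuous_mul.
have c2 : 0 < c / 2 by rewrite divr_gt0.
have [C C0 hC] := kC _ c2.
exists (C * D), (c / 2); split => //; first exact: mulr_ge0.
move=> y; rewrite normrM; apply: le_trans (ler_pM _ _ (hC y) (fD y)) _ => //.
rewrite mulrACA -expRD ler_wpM2l ?mulr_ge0// ler_expR.
by rewrite -mulrDl; have := dotpp_ge0 y; rewrite {2}[c]splitr; lra.
Qed.

Lemma gdec_gauss d s (x : 'rV[R]_d) : 0 < s ->
  gdec (fun y => expR (- s * dotp (y - x) (y - x))).
Proof.
move=> s0.
rewrite (_ : (fun y => _) = fun y => expR (- s * dotp x x) * (expR (dotp ((2 * s) *: x) y) * expR (- s * dotp y y))).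
  apply: gdecZ; apply: gdecM; first exact: sgrow_exp_dotp.
  split.
    apply: (continuous_comp_real (@continuous_expR R)).
    apply: continuous_mul; first exact: continuous_cst.
    by have [] := sgrow_dotpp d.
  by exists 1, s; split => // y; rewrite mul1r ger0_norm ?expR_ge0.
by apply/funext => y; rewrite -!expRD; congr expR; rewrite !dotpE (dotpC y x); ring.
Qed.

Lemma Riint_gauss d s (x : 'rV[R]_d) : 0 < s ->
  Riint (fun y => expR (- s * dotp (y - x) (y - x))) = Num.sqrt (pi / s) ^+ d.
Proof.
move=> s0; elim: d x => [|d ih] x.
  by rewrite /= /dotp big_ord0 mulr0 expR0 expr0.
rewrite /= -[x](@consr_split R d) exprS -(ih (rsubmx (x : 'rV[R]_(1 + d)))) -RiintZ; last exact: gdec_gauss.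
congr Riint; apply/funext => y; rewrite /slice.
under eq_Rintegral do rewrite consrB dotp_consr mulrDr expRD -expr2.
rewrite RintegralZr ?Rintegral_gauss//.
exact: integrable_gauss.
Qed.

End GaussianDecay.

(** * Gaussian moments and the heat flow *)

Section QuadraticRemainder.
Variable R : realType.

(** Differentiation under the integral always comes with a quadratic remainder, so difference
    quotients never require a limit theorem for integrals. *)
Lemma is_derive_quad (f : R -> R) (x l C e : R) : 0 < e ->
  (forall t, `|t| <= e -> `|f (x + t) - f x - t * l| <= C * t ^+ 2) ->
  is_derive x 1 f l.
Proof.
move=> e0 H.
have cv : h^-1 *: (f (h *: 1 + x) - f x) @[h --> 0^'] --> l.
  apply/cvgrPdist_le => eps eps0; near=> h.
  have h0 : h != 0 by near: h; exact: nbhs_dnbhs_neq.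
  have he : `|h| <= e.
    near: h; apply: dnbhs0_le => //.
  have hC : `|h| <= eps / (`|C| + 1).
    by near: h; apply: dnbhs0_le; rewrite divr_gt0// ltr_pwDr.
  have := H _ he; rewrite distrC => hh.
  rewrite -[l](mulKf h0) /GRing.scale/= -mulrBr normrM normfV mulr1.
  rewrite ler_pdivrMl ?normr_gt0// (addrC h x).
  apply: le_trans hh _.
  apply: le_trans (_ : `|C| * `|h| ^+ 2 <= _).
    by rewrite real_normK ?num_real// ler_wpM2r ?sqr_ge0// ler_norm.
  rewrite expr2 mulrCA ler_wpM2l//.
  move: hC; rewrite ler_pdivlMr ?ltr_pwDr// => hC.
  apply: le_trans hC; rewrite mulrC ler_wpM2l//; lra.
apply: DeriveDef; first by apply/cvg_ex; exists l.
exact: cvg_lim cv.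
Unshelve. all: end_near. Qed.

Lemma expR_taylor1 (t : R) : `|expR t - 1 - t| <= t ^+ 2 * expR `|t|.
Proof.
have h1 := expR_ge1Dx t.
have h2 : expR t - 1 <= t * expR t.
  have := expR_ge1Dx (- t); rewrite -(ler_pM2r (expR_gt0 t)) -expRD addNr expR0.
  by rewrite mulrDl mul1r mulNr; lra.
rewrite ger0_norm; last by lra.
have [t0|t0] := leP 0 t.
  rewrite ger0_norm//; have : t * (expR t - 1) <= t * (t * expR t) by rewrite ler_wpM2l.
  rewrite mulrA -expr2; lra.
apply: le_trans (_ : t ^+ 2 <= _).
  have : t * (expR t - 1) <= t * t by apply: ler_wnM2l; [exact: ltW|lra].
  rewrite expr2; lra.
by rewrite ler_peMr ?sqr_ge0// -expR0 ler_expR.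
Qed.

End QuadraticRemainder.

Section GaussMoments.
Variables (R : realType) (d : nat) (h : 'rV[R]_d -> R).
Hypothesis sh : sgrow h.
Implicit Types (s : R) (k : 'rV[R]_d -> R) (x : 'rV[R]_d).

(** Here [s] is the rate of the Gaussian, not a time. The flow and its derivatives are combinations
    of such moments with polynomial weights [k]. *)
Definition gmom s x k : R :=
  Riint (fun y => k y * (expR (- s * dotp (y - x) (y - x)) * h y)).

Lemma gdec_gmom s x k : 0 < s -> sgrow k ->
  gdec (fun y => k y * (expR (- s * dotp (y - x) (y - x)) * h y)).
Proof.
move=> s0 sk; apply: gdecM => //.
rewrite (_ : (fun y => _) = fun y => h y * expR (- s * dotp (y - x) (y - x))).
  by apply: gdecM => //; exact: gdec_gauss.
by apply/funext => y; rewrite mulrC.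
Qed.

Lemma gmomD s x k l : 0 < s -> sgrow k -> sgrow l ->
  gmom s x (fun y => k y + l y) = gmom s x k + gmom s x l.
Proof.
move=> s0 sk sl; rewrite /gmom -RiintD; [|exact: gdec_gmom|exact: gdec_gmom].
by congr Riint; apply/funext => y; rewrite mulrDl.
Qed.

Lemma gmomZ s x c k : 0 < s -> sgrow k ->
  gmom s x (fun y => c * k y) = c * gmom s x k.
Proof.
move=> s0 sk; rewrite /gmom -RiintZ; last exact: gdec_gmom.
by congr Riint; apply/funext => y; rewrite -mulrA.
Qed.

Lemma gmomB s x k l : 0 < s -> sgrow k -> sgrow l ->
  gmom s x (fun y => k y - l y) = gmom s x k - gmom s x l.
Proof.
move=> s0 sk sl; rewrite -[- gmom s x l]mulN1r -gmomZ// -gmomD//; last exact: sgrowZ.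
by congr (gmom _ _ _); apply/funext => y; rewrite mulN1r.
Qed.

Lemma gmom_sum n s x (k : 'I_n -> 'rV[R]_d -> R) : 0 < s -> (forall i, sgrow (k i)) ->
  gmom s x (fun y => \sum_(i < n) k i y) = \sum_(i < n) gmom s x (k i).
Proof.
move=> s0 sk; rewrite /gmom -Riint_sum; last by move=> i; exact: gdec_gmom.
by congr Riint; apply/funext => y; rewrite mulr_suml.
Qed.

(** Moving the centre and changing the rate both perturb the exponent by some [a] with |a| <=
    r(|y-x|^2 + 1). As r <= s/2, half of the Gaussian absorbs exp|a|, and [expR_taylor1] bounds the
    remainder by r^2 times a fixed integrable function; hence [C] is uniform in [r] and [a]. *)
Lemma gmom_expand s x k : 0 < s -> sgrow k -> exists2 C : R, 0 <= C &
  forall (r : R) (a : 'rV[R]_d -> R), sgrow a -> 0 <= r <= s / 2 ->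
  (forall y, `|a y| <= r * (dotp (y - x) (y - x) + 1)) ->
  `|Riint (fun y => k y * (expR (- s * dotp (y - x) (y - x) + a y) * h y)) - gmom s x k
    - gmom s x (fun y => k y * a y)| <= C * r ^+ 2.
Proof.
move=> s0 sk; have s2 : 0 < s / 2 by rewrite divr_gt0.
pose q y := dotp (y - x) (y - x) + 1.
have sq : sgrow q by apply: sgrowD; [exact: sgrow_dotppB|exact: sgrow_cst].
pose D y := `|(q y ^+ 2 * expR (s / 2)) * (k y * (expR (- (s / 2) * dotp (y - x) (y - x)) * h y))|.
have gD : gdec D.
  apply: gdec_norm; apply: gdecM; last exact: gdec_gmom.
  by apply: sgrowM; [exact: sgrowX|exact: sgrow_cst].
exists (Riint D); first by apply: Riint_ge0 => // y; rewrite /D normr_ge0.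
move=> r a sa /andP[r0 rs] ar.
set f := fun y => k y * (expR (- s * dotp (y - x) (y - x)) * h y).
have gf : gdec f by exact: gdec_gmom.
have gfa : gdec (fun y => k y * a y * (expR (- s * dotp (y - x) (y - x)) * h y)).
  by apply: gdec_gmom => //; exact: sgrowM.
set F := fun y => k y * (expR (- s * dotp (y - x) (y - x) + a y) * h y).
have FE y : F y - f y - k y * a y * (expR (- s * dotp (y - x) (y - x)) * h y) =
  f y * (expR (a y) - 1 - a y).
  by rewrite /F /f expRD; ring.
have bnd y : `|F y - f y - k y * a y * (expR (- s * dotp (y - x) (y - x)) * h y)| <=
    r ^+ 2 * D y.
  rewrite FE normrM.
  have q1 : 0 <= dotp (y - x) (y - x) := dotpp_ge0 (y - x).
  have qn : 0 <= q y by rewrite /q addr_ge0.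
  have a2 : a y ^+ 2 <= r ^+ 2 * q y ^+ 2.
    rewrite -exprMn -real_normK ?num_real// ler_sqr ?nnegrE//.
    by rewrite mulr_ge0// addr_ge0.
  have ea : expR `|a y| <= expR (s / 2) * expR (s / 2 * dotp (y - x) (y - x)).
    rewrite -expRD ler_expR; apply: le_trans (ar y) _.
    have : r * (dotp (y - x) (y - x) + 1) <= s / 2 * (dotp (y - x) (y - x) + 1).
      by rewrite ler_wpM2r// addr_ge0.
    lra.
  have : `|expR (a y) - 1 - a y| <= r ^+ 2 * q y ^+ 2 * (expR (s / 2) * expR (s / 2 * dotp (y - x) (y - x))).
    apply: le_trans (expR_taylor1 _) _.
    by apply: ler_pM => //; rewrite ?sqr_ge0 ?expR_ge0.
  move=> hh; apply: le_trans (ler_wpM2l (normr_ge0 (f y)) hh) _.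
  rewrite /D /f !normrM !(ger0_norm (expR_ge0 _)) !(ger0_norm qn) -[q y * q y]expr2.
  have -> : expR (- s * dotp (y - x) (y - x)) =
     expR (- (s / 2) * dotp (y - x) (y - x)) * expR (- (s / 2) * dotp (y - x) (y - x)).
    by rewrite -expRD; congr expR; field.
  set E1 := expR (- (s / 2) * _); set E2 := expR (s / 2 * _).
  have E12 : E1 * E2 = 1 by rewrite /E1 /E2 -expRD mulNr addNr expR0.
  have -> : `|k y| * (E1 * E1 * `|h y|) * (r ^+ 2 * q y ^+ 2 * (expR (s / 2) * E2)) =
    r ^+ 2 * (q y ^+ 2 * expR (s / 2) * (`|k y| * (E1 * `|h y|))) * (E1 * E2) by ring.
  by rewrite E12 mulr1.
have cF : continuous F.
  apply: continuous_mul; first by case: sk.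
  apply: continuous_mul; last by case: sh.
  apply: (continuous_comp_real (@continuous_expR R)); apply: continuous_add; last by case: sa.
  apply: continuous_mul; first exact: continuous_cst.
  by case: (sgrow_dotppB x).
have gF : gdec F.
  pose G y := r ^+ 2 * D y + (`|f y| + `|k y * a y * (expR (- s * dotp (y - x) (y - x)) * h y)|).
  apply: (@gdec_le _ _ _ G) => //; last first.
    by apply: gdecD; [exact: gdecZ|apply: gdecD; exact: gdec_norm].
  move=> y; rewrite /G.
  rewrite -[F y](subrK (f y)) -[F y - f y](subrK (k y * a y * (expR (- s * dotp (y - x) (y - x)) * h y))).
  rewrite -addrA (addrC _ (f y)); apply: le_trans (ler_normD _ _) _.
  by apply: lerD => //; apply: le_trans (ler_normD _ _) _.
rewrite /gmom -RiintB// -RiintB//; last exact: gdecB.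
rewrite mulrC -RiintZ//; apply: norm_Riint_le => //; last exact: gdecZ.
by apply: gdecB => //; exact: gdecB.
Qed.

End GaussMoments.

Section RealDerivatives.
Variable R : realType.
Implicit Types (f g : R -> R) (x a b c : R).

Lemma der_add f g x a b : is_derive x 1 f a -> is_derive x 1 g b ->
  is_derive x 1 (fun t => f t + g t) (a + b).
Proof. by move=> hf hg; exact: is_deriveD. Qed.

Lemma der_sub f g x a b : is_derive x 1 f a -> is_derive x 1 g b ->
  is_derive x 1 (fun t => f t - g t) (a - b).
Proof. by move=> hf hg; exact: is_deriveB. Qed.

Lemma der_mul f g x a b : is_derive x 1 f a -> is_derive x 1 g b ->
  is_derive x 1 (fun t => f t * g t) (a * g x + f x * b).
Proof.
move=> hf hg; apply: is_derive_eq (is_deriveM hf hg) _.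
by rewrite /GRing.scale/= addrC (mulrC (g x)).
Qed.

Lemma der_cst x c : is_derive x 1 (fun=> c) 0.
Proof. exact: is_derive_cst. Qed.

Lemma der_id x : is_derive x 1 (fun t => t) 1.
Proof. exact: is_derive_id. Qed.

Lemma der_mulc c f x a : is_derive x 1 f a -> is_derive x 1 (fun t => c * f t) (c * a).
Proof.
by move=> hf; apply: is_derive_eq (der_mul (der_cst x c) hf) _; rewrite mul0r add0r.
Qed.

Lemma der_opp f x a : is_derive x 1 f a -> is_derive x 1 (fun t => - f t) (- a).
Proof. by move=> hf; exact: is_deriveN. Qed.

Lemma der_comp f g x a b : is_derive (g x) 1 f a -> is_derive x 1 g b ->
  is_derive x 1 (fun t => f (g t)) (a * b).
Proof. by move=> hf hg; exact: is_derive1_comp. Qed.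

Lemma der_ln f x a : 0 < f x -> is_derive x 1 f a -> is_derive x 1 (fun t => ln (f t)) (a / f x).
Proof.
move=> f0 hf; apply: is_derive_eq (der_comp (is_derive1_ln f0) hf) _.
by rewrite mulrC.
Qed.

Lemma der_inv f x a : f x != 0 -> is_derive x 1 f a ->
  is_derive x 1 (fun t => (f t)^-1) (- a / f x ^+ 2).
Proof.
move=> f0 hf; apply: is_derive_eq (is_deriveV f0 hf) _.
by rewrite /GRing.scale/= mulNr mulrC mulNr.
Qed.

Lemma der_div f g x a b : g x != 0 -> is_derive x 1 f a -> is_derive x 1 g b ->
  is_derive x 1 (fun t => f t / g t) (a / g x - f x * b / g x ^+ 2).
Proof.
move=> g0 hf hg; apply: is_derive_eq (der_mul hf (der_inv g0 hg)) _.
by rewrite mulNr mulrN mulrA.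
Qed.

Lemma der_unshift f x a : is_derive (0 : R) 1 (fun t : R => f (x + t)) a -> is_derive x 1 f a.
Proof.
move=> hf.
have := @der_comp (fun t => f (x + t)) (fun t => t - x) x a 1; rewrite subrr mulr1 => /(_ hf) h.
rewrite (_ : f = fun t => f (x + (t - x))).
  by apply: h; apply: is_derive_eq (der_sub (der_id x) (der_cst x x)) _; rewrite subr0.
by apply/funext => t; rewrite addrCA subrr addr0.
Qed.

Lemma der_continuous f x a : is_derive x 1 f a -> {for x, continuous f}.
Proof. by move=> [h _]; apply: differentiable_continuous; exact/derivable1_diffP. Qed.

End RealDerivatives.

Section GaussMomentsCalculus.
Variables (R : realType) (d : nat) (h : 'rV[R]_d -> R).
Hypothesis sh : sgrow h.
Implicit Types (s t : R) (k : 'rV[R]_d -> R) (x v w : 'rV[R]_d).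

(** Coordinatewise 2|w_i| <= w_i^2 + 1. *)
Lemma dotp_le_norm w v : 2 * `|dotp w v| <= `|v| * (dotp w w + d%:R).
Proof.
have : `|dotp w v| <= \sum_(i < d) `|w ord0 i * v ord0 i| by exact: ler_norm_sum.
move=> h1; apply: le_trans (_ : \sum_(i < d) 2 * `|w ord0 i * v ord0 i| <= _).
  by rewrite -mulr_sumr ler_wpM2l.
rewrite (_ : d%:R = \sum_(i < d) 1); last by rewrite sumr_const card_ord.
rewrite /dotp -big_split/= mulr_sumr; apply: ler_sum => i _.
rewrite normrM (mulrC `|w _ _|) mulrCA; apply: ler_pM => //.
  exact: coord_le_norm.
have := sqr_ge0 (`|w ord0 i| - 1); rewrite -expr2 -[w ord0 i ^+ 2]real_normK ?num_real//.
by rewrite sqrrB1; lra.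
Qed.

Lemma gmom_dist_le s x v t y : 0 < s -> `|v| <= 1 ->
  `|- t * dotp (y - (x + v)) (y - (x + v)) + s * dotp (y - x) (y - x)| <=
  (2 * d.+1%:R * `|t - s| + s * (2 * d.+1%:R) * `|v|) * (dotp (y - x) (y - x) + 1).
Proof.
move=> s0 v1; rewrite opprD addrA; move: (y - x) => w.
have E : dotp (w - v) (w - v) = dotp w w - 2 * dotp w v + dotp v v.
  by rewrite !dotpE (dotpC v w); ring.
have -> : - t * dotp (w - v) (w - v) + s * dotp w w =
  - (t - s) * dotp (w - v) (w - v) + s * (2 * dotp w v - dotp v v).
  by rewrite E; ring.
have w0 := dotpp_ge0 w.
have n0 : (0 : R) <= d%:R by [].
have dS : d.+1%:R = d%:R + 1 :> R by rewrite -natr1.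
have vv : dotp v v <= d%:R * `|v|.
  apply: le_trans (dotpp_le_norm v) _; rewrite ler_wpM2l// expr2.
  by rewrite ler_piMl.
have v0 := dotpp_ge0 v.
have dv1 : d%:R * `|v| <= d%:R by rewrite ler_piMr.
have nv := normr_ge0 v.
have wv := dotp_le_norm w v.
have b1 : dotp (w - v) (w - v) <= 2 * d.+1%:R * (dotp w w + 1).
  have : dotp (w - v) (w - v) <= 2 * dotp w w + 2 * dotp v v.
    by have := dotpp_ge0 (w + v); rewrite E !dotpE (dotpC v w); lra.
  rewrite dS; have : 0 <= d%:R * dotp w w by rewrite mulr_ge0.
  lra.
have b2 : `|2 * dotp w v - dotp v v| <= 2 * d.+1%:R * `|v| * (dotp w w + 1).
  apply: le_trans (ler_normB _ _) _.
  rewrite normrM normr_nat (ger0_norm v0) dS.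
  have := mulr_ge0 nv w0; have := mulr_ge0 n0 (mulr_ge0 nv w0).
  move: wv; rewrite mulrDr; lra.
apply: le_trans (ler_normD _ _) _; rewrite !normrM normrN (ger0_norm (ltW s0)).
rewrite [X in _ <= X]mulrDl; apply: lerD.
  by rewrite (ger0_norm (dotpp_ge0 _)) (mulrC _ `|t - s|) -mulrA ler_wpM2l.
have -> : s * (2 * d.+1%:R) * `|v| * (dotp w w + 1) = s * (2 * d.+1%:R * `|v| * (dotp w w + 1)) by ring.
by rewrite ler_wpM2l// ltW.
Qed.

Lemma sgrow_dist s x v t :
  sgrow (fun y : 'rV[R]_d => - t * dotp (y - (x + v)) (y - (x + v)) + s * dotp (y - x) (y - x)).
Proof. by apply: sgrowD; apply: sgrowZ; exact: sgrow_dotppB. Qed.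

Lemma gmom_distE s x v t k :
  gmom h t (x + v) k = Riint (fun y => k y *
   (expR (- s * dotp (y - x) (y - x) + (- t * dotp (y - (x + v)) (y - (x + v)) + s * dotp (y - x) (y - x)))
     * h y)).
Proof. by rewrite /gmom; congr Riint; apply/funext => y; congr (_ * (expR _ * _)); ring. Qed.

(** The exponent changes by 2s<y-x,v> - s|v|^2. The linear part gives the derivative; the quadratic
    part has the order of the remainder and accounts for the second summand of the constant. *)
Lemma gmom_shift s x k : 0 < s -> sgrow k -> exists C e : R, [/\ 0 <= C, 0 < e &
  forall v, `|v| <= e ->
  `|gmom h s (x + v) k - gmom h s x k
    - 2 * s * gmom h s x (fun y => k y * dotp (y - x) v)| <= C * `|v| ^+ 2].
Proof.
move=> s0 sk; have [C C0 HC] := gmom_expand sh x s0 sk.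
set D := s * (2 * d.+1%:R).
have D0 : 0 < D by rewrite mulr_gt0.
exists (C * D ^+ 2 + s * d%:R * `|gmom h s x k|), (Num.min 1 (s / 2 / D)); split.
- by rewrite addr_ge0// ?mulr_ge0 ?sqr_ge0// ltW.
- by rewrite lt_min ltr01 divr_gt0// divr_gt0.
move=> v; rewrite le_min => /andP[v1 v2].
have := HC (D * `|v|) _ (sgrow_dist s x v s).
rewrite -gmom_distE.
have -> : 0 <= D * `|v| <= s / 2.
  by rewrite mulr_ge0 ?(ltW D0)// mulrC -ler_pdivlMr.
move=> /(_ isT) HH.
have {HH} : `|gmom h s (x + v) k - gmom h s x k -
   gmom h s x (fun y => k y * (- s * dotp (y - (x + v)) (y - (x + v)) + s * dotp (y - x) (y - x)))|
   <= C * (D * `|v|) ^+ 2.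
  apply: HH => y; apply: le_trans (gmom_dist_le x s y s0 v1) _.
  by rewrite subrr normr0 mulr0 add0r.
have -> : gmom h s x (fun y => k y * (- s * dotp (y - (x + v)) (y - (x + v)) + s * dotp (y - x) (y - x)))
  = 2 * s * gmom h s x (fun y => k y * dotp (y - x) v) - s * dotp v v * gmom h s x k.
  have sk2 : sgrow (fun y => k y * dotp (y - x) v) by apply: sgrowM => //; exact: sgrow_dotpB.
  rewrite -!gmomZ// -gmomB//; [|exact: sgrowZ|exact: sgrowZ].
  congr (gmom _ _ _ _); apply/funext => y.
  rewrite opprD addrA; move: (y - x) => w; rewrite !dotpE (dotpC v w); ring.
set A := gmom _ _ (x + v) k; set B := gmom _ _ x k; set M := gmom _ _ _ _ => H1.
have -> : A - B - 2 * s * M = (A - B - (2 * s * M - s * dotp v v * B)) - s * dotp v v * B by ring.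
apply: le_trans (ler_normB _ _) _; rewrite [X in _ <= X]mulrDl; apply: lerD.
  by move: H1; rewrite exprMn [X in _ <= X]mulrA.
rewrite !normrM (ger0_norm (ltW s0)) (ger0_norm (dotpp_ge0 v)).
rewrite -!mulrA ler_wpM2l ?(ltW s0)// (mulrC `|B|) mulrA ler_wpM2r//.
exact: dotpp_le_norm.
Qed.

Lemma gmom_time s x k : 0 < s -> sgrow k ->
  is_derive s 1 (fun t => gmom h t x k) (- gmom h s x (fun y => k y * dotp (y - x) (y - x))).
Proof.
move=> s0 sk; have [C C0 HC] := gmom_expand sh x s0 sk.
have s2 : 0 < s / 2 by rewrite divr_gt0.
apply: (@is_derive_quad _ _ _ _ C (s / 2)) => // t ts.
have sq : sgrow (fun y => - t * dotp (y - x) (y - x)) by apply: sgrowZ; exact: sgrow_dotppB.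
have := HC `|t| _ sq; rewrite ts normr_ge0 real_normK ?num_real// => /(_ isT) HH.
have -> : t * - gmom h s x (fun y => k y * dotp (y - x) (y - x)) =
    gmom h s x (fun y => k y * (- t * dotp (y - x) (y - x))).
  rewrite mulrN -mulNr -gmomZ//; last by apply: sgrowM => //; exact: sgrow_dotppB.
  by congr (gmom _ _ _ _); apply/funext => y; rewrite mulrCA.
have -> : gmom h (s + t) x k = Riint (fun y => k y * (expR (- s * dotp (y - x) (y - x) + - t * dotp (y - x) (y - x)) * h y)).
  by rewrite /gmom; congr Riint; apply/funext => y; rewrite -mulrDl opprD.
apply: HH => y; rewrite normrM normrN ler_wpM2l// ger0_norm ?dotpp_ge0//.
by rewrite lerDl.
Qed.

(** In [gmom_expand] the first-order term is at most r times the moment [M], and r is linear in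
    |t-s| and |v|. *)
Lemma gmom_continuous s x k : 0 < s -> sgrow k -> forall eps : R, 0 < eps ->
  exists2 e : R, 0 < e & forall t v, `|t - s| <= e -> `|v| <= e ->
  `|gmom h t (x + v) k - gmom h s x k| <= eps.
Proof.
move=> s0 sk eps eps0; have [C C0 HC] := gmom_expand sh x s0 sk.
pose q y := dotp (y - x) (y - x) + 1.
have sq : sgrow q by apply: sgrowD; [exact: sgrow_dotppB|exact: sgrow_cst].
have g1 : gdec (fun y => (k y * q y) * (expR (- s * dotp (y - x) (y - x)) * h y)).
  by apply: gdec_gmom => //; exact: sgrowM.
set M := Riint (fun y => `|(k y * q y) * (expR (- s * dotp (y - x) (y - x)) * h y)|).
have M0 : 0 <= M by apply: Riint_ge0 => //; exact: gdec_norm.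
set D := 2 * d.+1%:R + s * (2 * d.+1%:R).
have D0 : 0 < D by rewrite addr_gt0// mulr_gt0// mulr_gt0.
set K := C * D * (s / 2) + M * D.
have K0 : 0 <= K by rewrite addr_ge0// !mulr_ge0// ltW// divr_gt0.
exists (Num.min 1 (Num.min (s / 2 / D) (eps / (K + 1)))).
  by rewrite !lt_min ltr01 !divr_gt0// ltr_wpDl.
move=> t v; rewrite !le_min => /and3P[t1 t2 t3] /and3P[v1 v2 v3].
set r := 2 * d.+1%:R * `|t - s| + s * (2 * d.+1%:R) * `|v|.
have r0 : 0 <= r by rewrite addr_ge0// mulr_ge0// mulr_ge0// ltW.
have rD m : `|t - s| <= m -> `|v| <= m -> r <= D * m.
  move=> h1 h2; rewrite /r /D [X in _ <= X]mulrDl; apply: lerD; rewrite ler_wpM2l// mulr_ge0// ltW//.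
have rs : r <= s / 2 by apply: le_trans (rD _ t2 v2) _; rewrite mulrC divfK// gt_eqF.
have re : K * (r / D) <= eps.
  have rDe : r / D <= eps / (K + 1) by rewrite ler_pdivrMr// mulrC rD.
  apply: le_trans (ler_wpM2l K0 rDe) _.
  by rewrite mulrCA ler_piMr ?(ltW eps0)// ler_pdivrMr ?mul1r ?lerDl// ltr_wpDl.
have := HC r _ (sgrow_dist s x v t); rewrite -gmom_distE rs r0 => /(_ isT).
set a := (X in gmom h s x (fun y => k y * X y)) => HH.
have ar y : `|a y| <= r * q y by exact: gmom_dist_le.
have {}HH := HH ar.
have ga : `|gmom h s x (fun y => k y * a y)| <= r * M.
  rewrite /M -RiintZ; last exact: gdec_norm.
  apply: norm_Riint_le.
  - by apply: gdec_gmom => //; apply: sgrowM => //; exact: sgrow_dist.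
  - by apply: gdecZ; exact: gdec_norm.
  move=> y; rewrite !normrM; set E := `|expR _| * `|h y|.
  have -> : r * (`|k y| * `|q y| * E) = `|k y| * E * (r * `|q y|) by ring.
  rewrite mulrAC ler_wpM2l ?mulr_ge0//.
  by apply: le_trans (ar y) _; rewrite ler_wpM2l// ler_norm.
apply: le_trans re.
have -> : K * (r / D) = C * (s / 2) * r + r * M by rewrite /K; field; rewrite gt_eqF.
rewrite -[X in `|X|](subrK (gmom h s x (fun y => k y * a y))).
apply: le_trans (ler_normD _ _) _; apply: lerD => //.
apply: le_trans HH _; rewrite expr2 -mulrA ler_wpM2l// ler_wpM2r//.
Qed.

End GaussMomentsCalculus.

Section HeatFlow.
Variables (R : realType) (d : nat) (h : 'rV[R]_d -> R).
Hypothesis sh : sgrow h.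
Implicit Types (s t : R) (k : 'rV[R]_d -> R) (x v w : 'rV[R]_d).

(* The heat kernel at time [s] is [hnorm s * expR (- hpar s * |y - x|^2)]; [heat]
   is extended by [h] to [s <= 0], which makes it jointly continuous in [(s, x)]. *)
Definition hpar s : R := (2 * s)^-1.

Definition hnorm s : R := expR (- (d%:R / 2) * ln (2 * pi * s)).

Definition heat s x : R :=
  if 0 < s then hnorm s * gmom h (hpar s) x (fun=> 1) else h x.

Definition hgrad s x : 'rV[R]_d :=
  \row_i (hnorm s * (2 * hpar s) *
    gmom h (hpar s) x (fun y => dotp (y - x) (delta_mx ord0 i))).

Definition hhess s x v : R :=
  hnorm s * (4 * hpar s ^+ 2 * gmom h (hpar s) x (fun y => dotp (y - x) v ^+ 2)
             - 2 * hpar s * dotp v v * gmom h (hpar s) x (fun=> 1)).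

Lemma hpar_gt0 s : 0 < s -> 0 < hpar s.
Proof. by move=> s0; rewrite invr_gt0 mulr_gt0. Qed.

Lemma hnorm_gt0 s : 0 < hnorm s.
Proof. exact: expR_gt0. Qed.

Lemma heatE s x : 0 < s -> heat s x = hnorm s * gmom h (hpar s) x (fun=> 1).
Proof. by rewrite /heat => ->. Qed.

Lemma sqrt_expR_ln (a : R) : 0 < a -> Num.sqrt a = expR (ln a / 2).
Proof.
move=> a0; rewrite -[in LHS](@lnK _ a) ?posrE// {1}[ln a]splitr expRD.
by rewrite -expr2 sqrtr_sqr ger0_norm ?expR_ge0.
Qed.

Lemma hnorm_gauss s : 0 < s -> hnorm s * Num.sqrt (pi / hpar s) ^+ d = 1.
Proof.
move=> s0.
have -> : pi / hpar s = 2 * pi * s by rewrite /hpar invrK mulrCA mulrA.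
rewrite sqrt_expR_ln ?mulr_gt0 ?pi_gt0// -expRM_natl -expRD.
by rewrite -[RHS]expR0; congr expR; ring.
Qed.

Lemma heat_gt0 s x : (forall y, 0 < h y) -> 0 < heat s x.
Proof.
move=> h0; rewrite /heat; case: ifPn => // s0.
rewrite mulr_gt0 ?hnorm_gt0//; apply: Riint_gt0.
  by apply: gdec_gmom => //; [exact: hpar_gt0|exact: sgrow_cst].
by move=> y; rewrite mul1r mulr_gt0 ?expR_gt0.
Qed.

Lemma dotp_hgrad s x v : 0 < s ->
  dotp (hgrad s x) v = hnorm s * (2 * hpar s) * gmom h (hpar s) x (fun y => dotp (y - x) v).
Proof.
move=> s0; have p0 := hpar_gt0 s0.
have -> : (fun y => dotp (y - x) v) =
  fun y => \sum_(i < d) v ord0 i * dotp (y - x) (delta_mx ord0 i).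
  by apply/funext => y; apply: eq_bigr => i _; rewrite dotp_delta mulrC.
rewrite gmom_sum//; last by move=> i; apply: sgrowZ; exact: sgrow_dotpB.
rewrite mulr_sumr; apply: eq_bigr => i _; rewrite mxE gmomZ//; last exact: sgrow_dotpB.
ring.
Qed.

Lemma heat_shift s x : 0 < s -> exists C e : R, [/\ 0 <= C, 0 < e &
  forall v, `|v| <= e ->
  `|heat s (x + v) - heat s x - dotp (hgrad s x) v| <= C * `|v| ^+ 2].
Proof.
move=> s0; have p0 := hpar_gt0 s0.
have [C [e [C0 e0 H]]] := gmom_shift sh x p0 (@sgrow_cst R d 1).
exists (hnorm s * C), e; split => //; first by rewrite mulr_ge0// ltW ?hnorm_gt0.
move=> v ve; rewrite !heatE// dotp_hgrad// -!mulrA -!mulrBr normrM ger0_norm ?(ltW (hnorm_gt0 s))//.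
rewrite ler_wpM2l ?(ltW (hnorm_gt0 s))// mulrA.
apply: le_trans (H v ve); rewrite le_eqVlt; apply/orP; left; apply/eqP.
by congr (`| _ - 2 * _ * gmom _ _ _ _|); apply/funext => y; rewrite mul1r.
Qed.

Lemma gmom_line s x v k : 0 < s -> sgrow k ->
  is_derive (0 : R) 1 (fun t : R => gmom h s (x + t *: v) k)
    (2 * s * gmom h s x (fun y => k y * dotp (y - x) v)).
Proof.
move=> s0 sk; have [C [e [C0 e0 H]]] := gmom_shift sh x s0 sk.
have v0 : 0 < `|v| + 1 by rewrite ltr_wpDl.
apply: (@is_derive_quad _ _ _ _ (C * `|v| ^+ 2) (e / (`|v| + 1))); first exact: divr_gt0.
move=> t; rewrite ler_pdivlMr// => te; rewrite add0r scale0r addr0.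
have tv : `|t *: v| <= e.
  by rewrite normrZ; apply: le_trans te; rewrite ler_wpM2l// lerDl.
have -> : t * (2 * s * gmom h s x (fun y => k y * dotp (y - x) v)) =
  2 * s * gmom h s x (fun y => k y * dotp (y - x) (t *: v)).
  rewrite mulrCA -(gmomZ sh x t)//; last by apply: sgrowM => //; exact: sgrow_dotpB.
  by congr (_ * gmom _ _ _ _); apply/funext => y; rewrite dotpZr mulrCA.
apply: le_trans (H _ tv) _.
by rewrite normrZ exprMn real_normK ?num_real// -mulrA (mulrC (t ^+ 2)).
Qed.

Lemma heat_line s x v t : 0 < s ->
  is_derive t 1 (fun t => heat s (x + t *: v)) (dotp (hgrad s (x + t *: v)) v).
Proof.
move=> s0; apply: der_unshift.
have -> : (fun t' => heat s (x + (t + t') *: v)) =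
   fun t' => hnorm s * gmom h (hpar s) ((x + t *: v) + t' *: v) (fun=> 1).
  by apply/funext => r; rewrite (heatE _ s0) scalerDl addrA.
rewrite (dotp_hgrad _ _ s0) -mulrA; apply: der_mulc.
apply: is_derive_eq (gmom_line _ _ (hpar_gt0 s0) (@sgrow_cst R d 1)) _.
by congr (_ * gmom _ _ _ _); apply/funext => y; rewrite mul1r.
Qed.

(** In the gradient the weight <y-x,w> moves together with the centre of the Gaussian. Expanding it
    leaves weights independent of [x], to which [gmom_line] and continuity in the centre apply. *)
Lemma gmom_center s x w : 0 < s ->
  gmom h s x (fun y => dotp (y - x) w) =
  gmom h s x (fun y => dotp w y) - dotp x w * gmom h s x (fun=> 1).
Proof.
move=> s0; rewrite -gmomZ//; last exact: sgrow_cst.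
rewrite -gmomB//; [|exact: sgrow_dotpr|by apply: sgrowZ; exact: sgrow_cst].
by congr (gmom _ _ _ _); apply/funext => y; rewrite mulr1 dotpBl (dotpC w).
Qed.

Lemma hgrad_line s x v : 0 < s ->
  is_derive (0 : R) 1 (fun t : R => dotp (hgrad s (x + t *: v)) v) (hhess s x v).
Proof.
move=> s0; have p0 := hpar_gt0 s0.
have -> : (fun t => dotp (hgrad s (x + t *: v)) v) =
   fun t => hnorm s * (2 * hpar s) * (gmom h (hpar s) (x + t *: v) (fun y => dotp v y) -
      (dotp x v + t * dotp v v) * gmom h (hpar s) (x + t *: v) (fun=> 1)).
  by apply/funext => r; rewrite dotp_hgrad// gmom_center// dotpDl dotpZl.
have D1 := gmom_line x v p0 (@sgrow_dotpr R d v).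
have D2 := gmom_line x v p0 (@sgrow_cst R d 1).
have D3 : is_derive (0 : R) 1 (fun t : R => dotp x v + t * dotp v v) (dotp v v).
  apply: is_derive_eq (der_add (der_cst 0 _) (der_mul (der_id 0) (der_cst 0 _))) _.
  by rewrite add0r mulr0 addr0 mul1r.
apply: is_derive_eq (der_mulc _ (der_sub D1 (der_mul D3 D2))) _.
rewrite /hhess scale0r mul0r !addr0.
have sB := sgrow_dotpB x v.
have e1 : gmom h (hpar s) x (fun y => dotp (y - x) v ^+ 2) =
  gmom h (hpar s) x (fun y => dotp v y * dotp (y - x) v) - dotp x v * gmom h (hpar s) x (fun y => 1 * dotp (y - x) v).
  have -> : (fun y => 1 * dotp (y - x) v) = (fun y => dotp (y - x) v).
    by apply/funext => y; rewrite mul1r.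
  rewrite -gmomZ// -gmomB//; [|by apply: sgrowM => //; exact: sgrow_dotpr|exact: sgrowZ].
  congr (gmom _ _ _ _); apply/funext => y.
  by rewrite expr2 -mulrBl dotpBl (dotpC v).
rewrite e1; ring.
Qed.

Definition hlap s x : R :=
  hnorm s * (4 * hpar s ^+ 2 * gmom h (hpar s) x (fun y => dotp (y - x) (y - x))
             - 2 * hpar s * d%:R * gmom h (hpar s) x (fun=> 1)).

(** Stated for any frame with these two properties, because the maximum principle uses both the
    standard basis and its mirror image. *)
Lemma sum_hhess s x (v : 'I_d -> 'rV[R]_d) : 0 < s ->
  (forall w, \sum_(i < d) dotp w (v i) ^+ 2 = dotp w w) ->
  \sum_(i < d) dotp (v i) (v i) = d%:R ->
  \sum_(i < d) hhess s x (v i) = hlap s x.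
Proof.
move=> s0 H1 H2; have p0 := hpar_gt0 s0.
rewrite /hhess -mulr_sumr sumrB; congr (_ * (_ - _)); last first.
  by rewrite -mulr_suml -mulr_sumr H2.
rewrite -mulr_sumr -gmom_sum//; last by move=> i; apply: sgrowX; exact: sgrow_dotpB.
by congr (_ * gmom _ _ _ _); apply/funext => y; rewrite H1.
Qed.

(** The heat equation: differentiating the rate produces the second moment, differentiating the
    normalisation produces the term in [d]. *)
Lemma heat_time s x : 0 < s -> is_derive s 1 (fun t => heat t x) (2^-1 * hlap s x).
Proof.
move=> s0; have p0 := hpar_gt0 s0.
pose F t := hnorm t * gmom h (hpar t) x (fun=> 1).
apply: (@near_eq_is_derive _ _ _ F).
  near=> t; rewrite /F heatE//; near: t.
  exact: lt_nbhsr.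
have s2 : 2 * s != 0 by rewrite gt_eqF// mulr_gt0.
have D1 : is_derive s 1 hpar (- 2 / (2 * s) ^+ 2).
  apply: is_derive_eq (der_inv s2 (der_mulc 2 (der_id s))) _.
  by rewrite mulr1.
have p2 : 0 < 2 * pi * s by rewrite !mulr_gt0// pi_gt0.
have D2 : is_derive s 1 hnorm (hnorm s * (- (d%:R / 2) * (2 * pi * 1 / (2 * pi * s)))).
  have H := der_mulc (- (d%:R / 2)) (der_ln p2 (der_mulc (2 * pi) (der_id s))).
  exact: (@der_comp _ expR (fun t => - (d%:R / 2) * ln (2 * pi * t)) s _ _ (is_derive_expR _) H).
have D3 := der_comp (gmom_time sh x p0 (@sgrow_cst R d 1)) D1.
apply: is_derive_eq (der_mul D2 D3) _.
have -> : (fun y => 1 * dotp (y - x) (y - x)) = (fun y => dotp (y - x) (y - x)).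
  by apply/funext => y; rewrite mul1r.
rewrite /hlap; move: (hnorm s) (gmom h _ x _) (gmom h _ x _) => c m1 m2.
have : (pi : R) != 0 by rewrite gt_eqF ?pi_gt0.
by move: pi => p pn0; rewrite /hpar; field; rewrite pn0 gt_eqF.
Unshelve. all: end_near. Qed.

Lemma hgrad_continuous s : 0 < s -> continuous (hgrad s).
Proof.
move=> s0 x; have p0 := hpar_gt0 s0.
have cg k : sgrow k -> continuous (fun x => gmom h (hpar s) x k).
  move=> sk z; apply/(@cvgrPdist_le _ _ _ (nbhs z)) => eps eps0.
  have [e e0 H] := gmom_continuous sh z p0 sk eps0.
  near=> z'.
  rewrite distrC -[z'](subrKC z); apply: H; first by rewrite subrr normr0 ltW.
  by rewrite distrC; near: z'; exact: cvgr_dist_le.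
apply/(@cvgrPdist_lt _ _ _ (nbhs x)) => eps eps0.
have H i : \forall z \near x, `|hgrad s x ord0 i - hgrad s z ord0 i| < eps.
  have ci : continuous (fun z => hgrad s z ord0 i).
    rewrite (_ : (fun z => _) = fun z => hnorm s * (2 * hpar s) *
      (gmom h (hpar s) z (fun y => dotp (delta_mx ord0 i) y)
        + - (z ord0 i * gmom h (hpar s) z (fun=> 1)))).
      apply: continuous_mul; first exact: continuous_cst.
      apply: continuous_add; first by apply: cg; exact: sgrow_dotpr.
      apply: continuous_opp; apply: continuous_mul; first exact: coord_continuous.
      by apply: cg; exact: sgrow_cst.
    by apply/funext => z; rewrite mxE gmom_center// dotp_delta.
  exact: (@cvgr_dist_lt _ _ _ (nbhs x) _ _ _ (ci x)).
have HH : \forall z \near x, forall i, `|hgrad s x ord0 i - hgrad s z ord0 i| < eps.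
  exact: (@filter_forall _ _ (fun i z => `|hgrad s x ord0 i - hgrad s z ord0 i| < eps) (nbhs x) _ H).
near=> z.
rewrite [X in X < _]/Num.Def.normr/= mx_normrE; apply/bigmax_ltP; split => // -[i j] _ /=.
rewrite (ord1 i).
have := near HH z; move=> /(_ _ j); rewrite !mxE; apply.
by [].
Unshelve. all: end_near. Qed.

End HeatFlow.

(** * Flow of positive data with quadratic decay: decay in space and continuity up to time zero *)

Section BoundedHeatFlow.
Variables (R : realType) (d : nat) (h : 'rV[R]_d -> R).
Hypothesis sh : sgrow h.
Hypothesis h_gt0 : forall y, 0 < h y.
Variable K : R.
Hypothesis hK : forall y, h y * (1 + dotp y y) <= K.
Implicit Types (s t : R) (x v w : 'rV[R]_d).

Local Notation gk s x y := (expR (- hpar s * dotp (y - x) (y - x))).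

Lemma hnorm_mass s x : 0 < s -> hnorm d s * Riint (fun y => gk s x y) = 1.
Proof. by move=> s0; rewrite Riint_gauss ?hpar_gt0// hnorm_gauss. Qed.

(** From q exp(-pq) <= (2/p) exp(-(p/2)q) with p = [hpar s]: here 2/p = 4s, and halving the rate
    multiplies the Gaussian mass by sqrt(2)^d. *)
Definition mom2 : R := 4 * Num.sqrt 2 ^+ d.

Lemma mom2_ge0 : 0 <= mom2.
Proof. by rewrite mulr_ge0// exprn_ge0// sqrtr_ge0. Qed.

Lemma gdec_mom2 s x : 0 < s -> gdec (fun y => dotp (y - x) (y - x) * gk s x y).
Proof.
move=> s0; apply: gdecM; first exact: sgrow_dotppB.
by apply: gdec_gauss; exact: hpar_gt0.
Qed.

Lemma hnorm_mom2 s x : 0 < s ->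
  hnorm d s * Riint (fun y => dotp (y - x) (y - x) * gk s x y) <= mom2 * s.
Proof.
move=> s0; have p0 := hpar_gt0 s0; have p2 : 0 < hpar s / 2 by rewrite divr_gt0.
apply: le_trans (_ : hnorm d s * Riint (fun y => 2 / hpar s * expR (- (hpar s / 2) * dotp (y - x) (y - x))) <= _).
  rewrite ler_wpM2l ?(ltW (hnorm_gt0 _ _))//; apply: le_Riint; first exact: gdec_mom2.
    by apply: gdecZ; exact: gdec_gauss.
  move=> y; set q := dotp _ _.
  have -> : expR (- hpar s * q) = expR (- (hpar s / 2) * q) * expR (- (hpar s / 2) * q).
    by rewrite -expRD; congr expR; field.
  rewrite mulrA ler_wpM2r ?expR_ge0//.
  rewrite ler_pdivlMr// mulrAC mulNr expRN ler_pdivrMr ?expR_gt0//.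
  have := expR_ge1Dx (hpar s / 2 * q); rewrite mulrC; lra.
rewrite RiintZ; last exact: gdec_gauss.
rewrite Riint_gauss// (_ : pi / (hpar s / 2) = 2 * (pi / hpar s)); last first.
  by field; rewrite gt_eqF.
rewrite sqrtrM// exprMn.
have -> : hnorm d s * (2 / hpar s * (Num.sqrt 2 ^+ d * Num.sqrt (pi / hpar s) ^+ d)) =
  (hnorm d s * Num.sqrt (pi / hpar s) ^+ d) * (2 / hpar s * Num.sqrt 2 ^+ d) by ring.
by rewrite hnorm_gauss// mul1r /hpar invrK /mom2 le_eqVlt; apply/orP; left; apply/eqP; ring.
Qed.

Lemma K_ge0 : 0 <= K.
Proof.
by apply: le_trans (hK 0); rewrite mulr_ge0 ?(ltW (h_gt0 _))// dotp0l addr0.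
Qed.

Lemma h_le_K y : h y <= K.
Proof.
by apply: le_trans (hK y); rewrite ler_peMr ?(ltW (h_gt0 _))// lerDl dotpp_ge0.
Qed.

Lemma gdec_heat s x : 0 < s -> gdec (fun y => 1 * (gk s x y * h y)).
Proof. by move=> s0; apply: gdec_gmom => //; [exact: hpar_gt0|exact: sgrow_cst]. Qed.

(* Every estimate of the heat flow is a pointwise comparison of [h] with an
   affine function of [|y - x|^2]. *)
Lemma heat_le s x (a b c : R) : 0 < s -> 0 <= b ->
  (forall y, c * h y <= a + b * dotp (y - x) (y - x)) -> c * heat h s x <= a + b * mom2 * s.
Proof.
move=> s0 b0 H; have p0 := hpar_gt0 s0.
rewrite heatE// mulrCA /gmom -RiintZ; last exact: gdec_heat.
apply: le_trans (_ : hnorm d s * Riint (fun y => a * gk s x y + b * (dotp (y - x) (y - x) * gk s x y)) <= _).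
  rewrite ler_wpM2l ?(ltW (hnorm_gt0 _ _))//; apply: le_Riint.
  - by apply: gdecZ; exact: gdec_heat.
  - by apply: gdecD; apply: gdecZ; [exact: gdec_gauss|exact: gdec_mom2].
  move=> y; rewrite mul1r mulrCA -[X in _ <= X](_ : gk s x y * (a + b * dotp (y - x) (y - x)) = _); last by ring.
  by rewrite ler_wpM2l ?expR_ge0.
rewrite RiintD; [|by apply: gdecZ; exact: gdec_gauss|by apply: gdecZ; exact: gdec_mom2].
rewrite !RiintZ; [|exact: gdec_mom2|exact: gdec_gauss].
rewrite mulrDr !(mulrCA (hnorm d s)) hnorm_mass// mulr1 lerD2l -mulrA ler_wpM2l//.
exact: hnorm_mom2.
Qed.

Lemma heat_decay s T x : 0 <= s <= T ->
  heat h s x * (1 + dotp x x) <= 2 * K + 2 * K * mom2 * T.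
Proof.
move=> /andP[]; rewrite le_eqVlt => /orP[/eqP<- T0|s0 sT].
  rewrite /heat ltxx; apply: le_trans (hK x) _.
  have := K_ge0; have := mulr_ge0 (mulr_ge0 (mulr_ge0 (ler0n R 2) K_ge0) mom2_ge0) T0; lra.
rewrite mulrC; apply: le_trans (_ : 2 * K + 2 * K * mom2 * s <= _); last first.
  by rewrite lerD2l ler_wpM2l// !mulr_ge0 ?K_ge0 ?mom2_ge0.
apply: heat_le => //; first by rewrite mulr_ge0 ?K_ge0.
move=> y.
(* The weight |x|^2 is traded for |y|^2, which [hK] controls, and |y-x|^2, whose mean under the heat
   kernel is of order s. *)
have h1 : dotp x x <= 2 * dotp y y + 2 * dotp (y - x) (y - x).
  have := dotpp_ge0 ((y - x) + y); rewrite !dotpE (dotpC y x); lra.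
have h2 := hK y; have h3 := h_le_K y; have h4 := h_gt0 y.
have q0 := dotpp_ge0 (y - x).
apply: le_trans (_ : (1 + (2 * dotp y y + 2 * dotp (y - x) (y - x))) * h y <= _).
  by rewrite ler_wpM2r ?lerD2l// ltW.
have h5 : dotp (y - x) (y - x) * h y <= dotp (y - x) (y - x) * K by rewrite ler_wpM2l.
move: h2 h5; rewrite [X in X <= _]mulrC; lra.
Qed.

Lemma near_pairP s x (e : R) : 0 < e ->
  \forall p \near (s, x), `|p.1 - s| < e /\ `|p.2 - x| < e.
Proof.
move=> e0; near=> p; split; near: p.
- by apply: (@cvgr_distC_lt _ _ _ (nbhs (s, x)) _ fst s); [exact: cvg_fst|].
- by apply: (@cvgr_distC_lt _ _ _ (nbhs (s, x)) _ snd x); [exact: cvg_snd|].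
Unshelve. all: end_near. Qed.

Lemma heat_continuous : continuous (fun p : R * 'rV[R]_d => heat h p.1 p.2).
Proof.
move=> [s x]; apply/(@cvgrPdist_le _ _ _ (nbhs (s, x))) => eps eps0 /=.
have [ch _] := sh.
have [s0|s0] := ltP 0 s.
  have p0 := hpar_gt0 s0.
  pose G (p : R * 'rV[R]_d) := hnorm d p.1 * gmom h (hpar p.1) p.2 (fun=> 1).
  have cG : G p @[p --> (s, x)] --> G (s, x).
    apply: cvgM.
      apply: (@cvg_comp _ _ _ fst (hnorm d) (nbhs (s, x)) (nbhs s)); first exact: cvg_fst.
      apply: (@cvg_comp _ _ _ (fun t => - (d%:R / 2) * ln (2 * pi * t)) expR (nbhs s)
         (nbhs (- (d%:R / 2) * ln (2 * pi * s)))); last exact: continuous_expR.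
      apply: cvgM; first exact: cvg_cst.
      apply: (@cvg_comp _ _ _ (fun t => 2 * pi * t) (@ln R) (nbhs s) (nbhs (2 * pi * s))).
        by apply: cvgM; [exact: cvg_cst|exact: cvg_id].
      by apply: continuous_ln; rewrite !mulr_gt0// pi_gt0.
    apply/(@cvgrPdist_le _ _ _ (nbhs (s, x))) => e e0.
    have [e1 e10 H] := gmom_continuous sh x p0 (@sgrow_cst R d 1) e0.
    have hp : \forall p \near (s, x), `|hpar p.1 - hpar s| <= e1.
      have : hpar p.1 @[p --> (s, x)] --> hpar s.
        apply: (@cvg_comp _ _ _ fst (@hpar R) (nbhs (s, x)) (nbhs s)); first exact: cvg_fst.
        have s2 : 2 * s != 0 by rewrite gt_eqF// mulr_gt0.
        exact: (der_continuous (der_inv s2 (der_mulc 2 (der_id s)))).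
      by move=> /cvgr_distC_le; apply.
    near=> p; rewrite /= distrC -[p.2](subrKC x).
    apply: H; first by near: p.
    by apply: ltW; apply: (proj2 (_ : `|p.1 - s| < e1 /\ `|p.2 - x| < e1)); near: p; exact: near_pairP.
  have H1 := @cvgr_dist_le _ _ _ (nbhs (s, x)) _ _ _ cG _ eps0.
  have H2 := near_pairP s x s0.
  near=> p.
  have [ps _] : `|p.1 - s| < s /\ `|p.2 - x| < s by near: p; exact: H2.
  have hG : `|G (s, x) - G p| <= eps by near: p; exact: H1.
  have p1 : 0 < p.1 by move: ps; rewrite ltr_norml; lra.
  by move: hG; rewrite /G !heatE.
(* At s <= 0: closeness to h(x) inside a ball of radius [r] and the bound [K] outside it merge into
   one quadratic bound, to which [heat_le] applies with both signs. *)
have -> : heat h s x = h x by rewrite /heat ltNge s0.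
have e2 : 0 < eps / 4 by rewrite divr_gt0.
have := ch x; move=> /(@cvgrPdist_le _ _ _ (nbhs x))/(_ _ e2) /nbhs_ballP[r /= r0 Hr].
have {}Hr y : `|y - x| < r -> `|h x - h y| <= eps / 4.
  by move=> yr; apply: Hr; rewrite -ball_normE /= distrC.
have hy y : `|h y - h x| <= eps / 4 + K / r ^+ 2 * dotp (y - x) (y - x).
  have [yr|yr] := ltP `|y - x| r.
    rewrite distrC; apply: le_trans (Hr _ yr) _; rewrite lerDl mulr_ge0 ?dotpp_ge0//.
    by rewrite divr_ge0 ?K_ge0// sqr_ge0.
  apply: le_trans (_ : K <= _).
    rewrite ler_norml; have := h_gt0 y; have := h_gt0 x; have := h_le_K y; have := h_le_K x; lra.
  have : K <= K / r ^+ 2 * dotp (y - x) (y - x).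
    rewrite mulrAC ler_pdivlMr ?exprn_gt0// ler_wpM2l ?K_ge0//.
    by apply: le_trans (norm_sqr_le_dotpp _); rewrite ler_sqr ?nnegrE// ltW.
  lra.
set B := K / r ^+ 2.
have B0 : 0 <= B by rewrite divr_ge0 ?K_ge0// sqr_ge0.
set D := 2 * B * (d%:R + mom2) + 1.
have D0 : 0 < D by rewrite ltr_wpDl// mulr_ge0 ?addr_ge0 ?mom2_ge0// mulr_ge0.
(* Below [r] for times t <= 0, where the flow is [h]; below eps/4/D so that the displacement |y-x|^2
   and the variance, of order t, together cost at most eps/4. *)
pose e := Num.min (Num.min 1 r) (eps / 4 / D).
have e0 : 0 < e by rewrite !lt_min ltr01 r0 !divr_gt0.
apply: filterS (near_pairP s x e0) => -[t y] /= [ts].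
rewrite {1}/e !lt_min => /andP[/andP[y1 yr] yD].
have te : t < e by move: ts; rewrite ltr_norml => /andP[_]; rewrite ltrBlDr => /lt_le_trans; apply; rewrite gerDl.
move: te; rewrite /e !lt_min => /andP[/andP[t1 tr] tD].
have [t0|t0] := ltP 0 t; last by rewrite /heat ltNge t0; apply: le_trans (Hr _ yr) _; lra.
have hb z : `|h z - h x| <= (eps / 4 + 2 * B * dotp (y - x) (y - x)) + 2 * B * dotp (z - y) (z - y).
  apply: le_trans (hy z) _; rewrite -/B -addrA lerD2l.
  have := dotpp_ge0 ((z - y) - (y - x)).
  have -> : z - x = (z - y) + (y - x) by rewrite addrA subrK.
  move: (z - y) (y - x) => p q; rewrite !dotpE (dotpC q p) => hh.
  have : B * (dotp p p + dotp p q + (dotp p q + dotp q q)) <= B * (2 * dotp q q + 2 * dotp p p).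
    by rewrite ler_wpM2l//; lra.
  lra.
have yy : dotp (y - x) (y - x) <= d%:R * (eps / 4 / D).
  apply: le_trans (dotpp_le_norm _) _; rewrite ler_wpM2l//.
  apply: le_trans (ltW yD); rewrite expr2 ler_piMl// ltW//.
have s2 : 0 <= 2 * B by rewrite mulr_ge0.
have final : (eps / 4 + 2 * B * dotp (y - x) (y - x)) + 2 * B * mom2 * t <= eps / 2.
  have h1 : 2 * B * dotp (y - x) (y - x) <= 2 * B * (d%:R * (eps / 4 / D)).
    by rewrite ler_wpM2l// mulr_ge0.
  have h2 : 2 * B * mom2 * t <= 2 * B * mom2 * (eps / 4 / D).
    by apply: ler_wpM2l (ltW tD); exact: mulr_ge0 s2 (mom2_ge0).
  have h3 : (2 * B * d%:R + 2 * B * mom2) * (eps / 4 / D) <= eps / 4.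
    rewrite mulrA ler_pdivrMr// mulrC ler_wpM2l ?(ltW e2)// /D; lra.
  lra.
have up : 1 * heat h t y <= h x + (eps / 4 + 2 * B * dotp (y - x) (y - x)) + 2 * B * mom2 * t.
  apply: heat_le => // z; have := hb z; rewrite ler_norml; lra.
have lo : -1 * heat h t y <= - h x + (eps / 4 + 2 * B * dotp (y - x) (y - x)) + 2 * B * mom2 * t.
  apply: heat_le => // z; have := hb z; rewrite ler_norml; lra.
rewrite ler_norml; lra.
Unshelve. all: end_near. Qed.

End BoundedHeatFlow.

(** * The maximum principle *)

Section Extrema.
Variable R : realType.
Implicit Types (f : R -> R) (t x l e : R).

Lemma der_epsilon f x l : is_derive x 1 f l -> forall eps : R, 0 < eps ->
  exists2 e : R, 0 < e & forall t, t != 0 -> `|t| < e -> `|(f (x + t) - f x) / t - l| < eps.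
Proof.
move=> [df <-] eps eps0; have : h^-1 *: (f (h *: 1 + x) - f x) @[h --> 0^'] --> 'D_1 f x.
  by move: df => /cvgP.
move=> /cvgrPdist_lt/(_ _ eps0); rewrite /dnbhs /within/= => /nbhs_ballP[e /= e0 H].
exists e => // t t0 te; have := H t; rewrite -ball_normE /= sub0r normrN => /(_ te t0).
by rewrite distrC /GRing.scale/= mulr1 [t + x]addrC mulrC.
Qed.

(** One-sided on purpose: a minimum at the final time can only be compared with earlier times, and
    [fourpt_twopt] applies it at the endpoint l = 1. *)
Lemma der_le0_leftmin f x l e : 0 < e -> is_derive x 1 f l ->
  (forall t, - e < t < 0 -> f x <= f (x + t)) -> l <= 0.
Proof.
move=> e0 df H; rewrite leNgt; apply/negP => l0.
have [e1 e10 H1] := der_epsilon df l0.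
pose t := - (Num.min e e1 / 2).
have m0 : 0 < Num.min e e1 by rewrite lt_min e0.
have t0 : t < 0 by rewrite oppr_lt0 divr_gt0.
have tm : - t < Num.min e e1 by rewrite opprK ltr_pdivrMr// ltr_pMr// ltr1n.
move: tm; rewrite lt_min => /andP[te te1].
have := H1 t; rewrite lt_eqF// ltr0_norm// => /(_ isT te1).
rewrite ltr_norml => /andP[]; rewrite ltrBrDl subrr => h _.
have : (f (x + t) - f x) / t <= 0.
  apply: mulr_ge0_le0; last by rewrite invr_le0 ltW.
  by rewrite subr_ge0 H// t0 andbT ltrNl.
by rewrite leNgt h.
Qed.

Lemma der_eq0_min f l e : 0 < e -> is_derive (0 : R) 1 f l ->
  (forall t, `|t| < e -> f 0 <= f t) -> l = 0.
Proof.
move=> e0 df H; apply/eqP; rewrite eq_le; apply/andP; split.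
  apply: (der_le0_leftmin e0 df) => t /andP[t1 t2].
  by rewrite add0r H// ltr0_norm// ltrNl.
rewrite -oppr_le0.
have dg : is_derive (0 : R) 1 (fun t => f (- t)) (- l).
  have := @der_comp _ f (fun t => - t) 0 l (-1); rewrite oppr0 mulrN1; apply => //.
apply: (der_le0_leftmin e0 dg) => t /andP[t1 t2].
by rewrite add0r oppr0 H// normrN ltr0_norm// ltrNl.
Qed.

(** The minimum forces f1(0) = 0. With a negative derivative, [f1] would be negative just to the
    right of 0, and the mean value theorem would give a value below the minimum. *)
Lemma der2_ge0_min f f1 l e : 0 < e ->
  (forall t, `|t| < e -> is_derive t 1 f (f1 t)) -> is_derive (0 : R) 1 f1 l ->
  (forall t, `|t| < e -> f 0 <= f t) -> 0 <= l.
Proof.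
move=> e0 df df1 H; rewrite leNgt; apply/negP => l0.
have f10 : f1 0 = 0 by apply: (der_eq0_min e0 (df 0 _)) => //; rewrite normr0.
have nl : 0 < - l by rewrite oppr_gt0.
have [e1 e10 H1] := der_epsilon df1 nl.
have m0 : 0 < Num.min e e1 by rewrite lt_min e0.
pose t := Num.min e e1 / 2.
have t0 : 0 < t by rewrite divr_gt0.
have : t < Num.min e e1 by rewrite ltr_pdivrMr// ltr_pMr// ltr1n.
rewrite lt_min => /andP[te te1].
have [c] : exists2 c, c \in `]0, t[%R & f t - f 0 = f1 c * (t - 0).
  apply: MVT => // [x|].
    rewrite in_itv /= => /andP[x0 xt]; apply: df.
    by rewrite gtr0_norm// (lt_trans xt).
  apply: derivable_within_continuous => x; rewrite in_itv /= => /andP[x0 xt].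
  by have [] := df x _; first by rewrite ger0_norm// (le_lt_trans xt).
rewrite in_itv /= => /andP[c0 ct] fc.
have := H1 c; rewrite gt_eqF// add0r f10 subr0 gtr0_norm// => /(_ isT (lt_trans ct te1)).
rewrite ltr_norml => /andP[_]; rewrite ltrBlDr addNr => h1.
have f1c : f1 c < 0 by rewrite -(pmulr_llt0 _ (_ : 0 < c^-1)) ?invr_gt0.
have : f t - f 0 < 0 by rewrite fc subr0 pmulr_llt0.
by rewrite subr_lt0 ltNge H// gtr0_norm.
Qed.

End Extrema.

Section LogCosh.
Variables (R : realType) (a : R).
Hypothesis a0 : 0 < a.
Implicit Types c p q : R.

(* [log cosh (a p)] up to the additive constant [log 2], which cancels in every use. *)
Definition psi p : R := ln (expR (a * p) + expR (- (a * p))).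

Definition psi1 p : R := a * tanh (a * p).

Definition psi2 p : R := a ^+ 2 * (1 - tanh (a * p) ^+ 2).

Lemma expRDN_gt0 (x : R) : 0 < expR x + expR (- x).
Proof. by rewrite addr_gt0 ?expR_gt0. Qed.

Lemma der_exp_lin c p : is_derive p 1 (fun t => expR (c * t)) (c * expR (c * p)).
Proof.
have H : is_derive p 1 (fun t => c * t) c.
  by apply: is_derive_eq (der_mulc c (der_id p)) _; rewrite mulr1.
apply: is_derive_eq (@der_comp _ expR (fun t => c * t) p _ _ (is_derive_expR _) H) _.
by rewrite mulrC.
Qed.

Lemma psi_derive p : is_derive p 1 psi (psi1 p).
Proof.
have D := der_add (der_exp_lin a p) (der_exp_lin (- a) p).
have : is_derive p 1 (fun t => ln (expR (a * t) + expR (- a * t)))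
  ((a * expR (a * p) + - a * expR (- a * p)) / (expR (a * p) + expR (- a * p))).
  by apply: der_ln => //; rewrite mulNr expRDN_gt0.
rewrite (_ : (fun t => _) = psi); last by apply/funext => t; rewrite mulNr.
move=> h; apply: is_derive_eq h _.
by rewrite /psi1 /tanh mulrA mulrBr !mulNr.
Qed.

Lemma psi1_derive p : is_derive p 1 psi1 (psi2 p).
Proof.
have D1 := der_sub (der_exp_lin a p) (der_exp_lin (- a) p).
have D2 := der_add (der_exp_lin a p) (der_exp_lin (- a) p).
have n0 : expR (a * p) + expR (- a * p) != 0 by rewrite mulNr gt_eqF ?expRDN_gt0.
have := der_mulc a (@der_div _ _ (fun t => expR (a * t) + expR (- a * t)) p _ _ n0 D1 D2).
rewrite (_ : (fun t => _) = psi1); last by apply/funext => t; rewrite mulNr.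
move=> h; apply: is_derive_eq h _; rewrite /psi2 /tanh -!mulNr.
move: n0; move: (expR (a * p)) (expR (- a * p)) => A B n0; field.
by rewrite n0.
Qed.

(** The logarithmic form of cosh(a .)'' = a^2 cosh(a .). The constant is the same at both radii, so
    their contributions cancel in [no_interior_min]. *)
Lemma psi2E p : psi2 p + psi1 p ^+ 2 = a ^+ 2.
Proof. by rewrite /psi2 /psi1; ring. Qed.

Lemma tanh_ge0 (x : R) : 0 <= x -> 0 <= tanh x.
Proof.
move=> x0; rewrite divr_ge0 ?(ltW (expRDN_gt0 _))// subr_ge0 ler_expR; lra.
Qed.

Lemma tanh_le1 (x : R) : tanh x <= 1.
Proof.
by rewrite ler_pdivrMr ?expRDN_gt0// mul1r; have := expR_gt0 (- x); lra.
Qed.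

Lemma psi_even p : psi (- p) = psi p.
Proof. by rewrite /psi mulrN opprK addrC. Qed.

Lemma psi_abs p : psi `|p| = psi p.
Proof. by have [_|_] := ger0P p => //; rewrite psi_even. Qed.

Lemma psi_MVT p q : p < q -> exists2 c, p < c < q & psi q - psi p = psi1 c * (q - p).
Proof.
move=> pq; have [|c hc E] := @MVT R psi psi1 p q pq (fun x _ => psi_derive x).
  by apply: derivable_within_continuous => x _; have [] := psi_derive x.
by exists c => //; move: hc; rewrite in_itv.
Qed.

Lemma psi_homo p q : 0 <= p -> p <= q -> psi p <= psi q.
Proof.
move=> p0; rewrite le_eqVlt => /orP[/eqP->//|pq].
have [c /andP[pc cq] E] := psi_MVT pq.
rewrite -subr_ge0 E mulr_ge0 ?subr_ge0 ?(ltW pq)// mulr_ge0 ?(ltW a0)//.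
by rewrite tanh_ge0// mulr_ge0 ?(ltW a0)//; lra.
Qed.

Lemma psi_le p q : `|p| <= q -> psi p <= psi q.
Proof. by move=> h; rewrite -psi_abs; exact: psi_homo. Qed.

Lemma psi_lip p q : p <= q -> psi q - psi p <= a * (q - p).
Proof.
rewrite le_eqVlt => /orP[/eqP->|pq]; first by rewrite !subrr mulr0.
have [c _ ->] := psi_MVT pq.
rewrite ler_wpM2r ?subr_ge0 ?(ltW pq)// /psi1 ler_piMr ?(ltW a0)//.
exact: tanh_le1.
Qed.

Lemma psi_continuous : continuous psi.
Proof. by move=> p; exact: der_continuous (psi_derive p). Qed.

End LogCosh.

Section Reflection.
Variables (R : realType) (d : nat) (e : 'rV[R]_d).
Hypothesis e1 : dotp e e = 1.

Definition reflect_dir (i : 'I_d) : 'rV[R]_d :=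
  delta_mx ord0 i - (2 * e ord0 i) *: e.

Lemma sum_sqr_delta (w : 'rV[R]_d) : \sum_(i < d) dotp w (delta_mx ord0 i) ^+ 2 = dotp w w.
Proof. by apply: eq_bigr => i _; rewrite dotp_delta expr2. Qed.

Lemma sum_dotp_delta : \sum_(i < d) dotp (delta_mx ord0 i : 'rV[R]_d) (delta_mx ord0 i) = d%:R.
Proof.
rewrite (eq_bigr (fun=> 1)) ?sumr_const ?card_ord// => i _.
by rewrite dotp_delta mxE !eqxx.
Qed.

(** A reflection is symmetric and isometric: pairing [w] with the image of a basis vector gives a
    coordinate of the image of [w], which has the same norm. *)
Lemma sum_sqr_reflect (w : 'rV[R]_d) : \sum_(i < d) dotp w (reflect_dir i) ^+ 2 = dotp w w.
Proof.
have E i : dotp w (reflect_dir i) ^+ 2 =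
  (w - (2 * dotp w e) *: e) ord0 i * (w - (2 * dotp w e) *: e) ord0 i.
  rewrite /reflect_dir dotpBr dotp_delta dotpZr !mxE expr2; ring.
rewrite (eq_bigr _ (fun i _ => E i)) -[LHS]/(dotp _ _).
by rewrite !dotpE e1 (dotpC e w); ring.
Qed.

Lemma sum_dotp_reflect : \sum_(i < d) dotp (reflect_dir i) (reflect_dir i) = d%:R.
Proof.
rewrite -sum_dotp_delta; apply: eq_bigr => i _.
rewrite /reflect_dir dotpBl !dotpBr !dotpZl !dotpZr e1 (dotpC (delta_mx ord0 i) e) !dotp_delta.
ring.
Qed.

End Reflection.

Section InteriorMinimum.
Variables (R : realType) (d : nat) (a delta eta T : R).
Variables (u : R -> 'rV[R]_d -> R) (N : R -> 'rV[R]_d -> 'rV[R]_d).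
Variables (H : R -> 'rV[R]_d -> 'rV[R]_d -> R) (Lap : R -> 'rV[R]_d -> R).
Implicit Types (t s l : R) (m x z v w : 'rV[R]_d).

Hypotheses (a0 : 0 < a) (delta0 : 0 < delta).
Hypothesis u_gt0 : forall s x, 0 < u s x.
Hypothesis u_line : forall s x v t, 0 < s ->
  is_derive t 1 (fun t => u s (x + t *: v)) (dotp (N s (x + t *: v)) v).
Hypothesis N_line : forall s x v, 0 < s ->
  is_derive (0 : R) 1 (fun t : R => dotp (N s (x + t *: v)) v) (H s x v).
Hypothesis sum_H : forall s x (v : 'I_d -> 'rV[R]_d), 0 < s ->
  (forall w, \sum_(i < d) dotp w (v i) ^+ 2 = dotp w w) ->
  \sum_(i < d) dotp (v i) (v i) = d%:R ->
  \sum_(i < d) H s x (v i) = Lap s x.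
Hypothesis u_time : forall s x, 0 < s ->
  is_derive s 1 (fun t => u t x) (2^-1 * Lap s x).

(* The shift by [delta] of the solution at the two inner points makes [cfg] positive
   outside a compact set while remaining a solution of the heat equation. *)
Definition cfg s m z l : R :=
  - ln (u s (m + z)) - ln (u s (m - z))
  + ln (u s (m + l *: z) + delta) + ln (u s (m - l *: z) + delta)
  + 2 * psi a (enorm z) - 2 * psi a (l * enorm z).

Lemma ln_line s x v c t : 0 < s -> 0 <= c ->
  is_derive t 1 (fun t => ln (u s (x + t *: v) + c))
    (dotp (N s (x + t *: v)) v / (u s (x + t *: v) + c)).
Proof.
move=> s0 c0.
have D := der_add (u_line x v t s0) (der_cst t c); rewrite addr0 in D.
by apply: (@der_ln _ (fun t => u s (x + t *: v) + c)) => //; rewrite ltr_pwDl.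
Qed.

Lemma ln_line2 s x v c : 0 < s -> 0 <= c ->
  is_derive (0 : R) 1 (fun t : R => dotp (N s (x + t *: v)) v / (u s (x + t *: v) + c))
    (H s x v / (u s x + c) - (dotp (N s x) v / (u s x + c)) ^+ 2).
Proof.
move=> s0 c0.
have D := der_add (u_line x v 0 s0) (der_cst 0 c); rewrite addr0 in D.
have n0 : u s (x + 0 *: v) + c != 0 by rewrite gt_eqF// ltr_pwDl.
have := @der_div _ _ (fun t => u s (x + t *: v) + c) 0 _ _ n0 (N_line x v s0) D.
move=> h; apply: is_derive_eq h _; rewrite scale0r addr0.
by rewrite exprMn exprVn -expr2.
Qed.

Section AtPoint.
Variables (s : R) (x1 x2 x3 x4 : 'rV[R]_d) (p q : R).
Hypothesis s0 : 0 < s.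

Let slope c x v := dotp (N s x) v / (u s x + c).
Let curv c x v := H s x v / (u s x + c) - slope c x v ^+ 2.

(** Common form of all tests of minimality. The four points and the two radii are unrelated here, so
    each test chooses its own displacements; the slack C t^2 enters only the second-order
    conclusion. *)
Lemma variation v1 v2 v3 v4 (c1 c2 C e0 : R) : 0 < e0 ->
  (forall t, `|t| < e0 ->
    - ln (u s x1) - ln (u s x2) + ln (u s x3 + delta) + ln (u s x4 + delta)
      + 2 * psi a p - 2 * psi a q <=
    - ln (u s (x1 + t *: v1)) - ln (u s (x2 + t *: v2))
    + ln (u s (x3 + t *: v3) + delta) + ln (u s (x4 + t *: v4) + delta)
    + 2 * psi a (p + t * c1) - 2 * psi a (q + t * c2) + C * t ^+ 2) ->
  - slope 0 x1 v1 - slope 0 x2 v2 + slope delta x3 v3 + slope delta x4 v4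
    + 2 * c1 * psi1 a p - 2 * c2 * psi1 a q = 0 /\
  0 <= - curv 0 x1 v1 - curv 0 x2 v2 + curv delta x3 v3 + curv delta x4 v4
    + 2 * c1 ^+ 2 * psi2 a p - 2 * c2 ^+ 2 * psi2 a q + 2 * C.
Proof.
move=> e00 Hmin.
(* The [+ 0] lets [ln_line] serve the unshifted outer points too. *)
pose G t := - ln (u s (x1 + t *: v1) + 0) - ln (u s (x2 + t *: v2) + 0)
    + ln (u s (x3 + t *: v3) + delta) + ln (u s (x4 + t *: v4) + delta)
    + 2 * psi a (p + t * c1) - 2 * psi a (q + t * c2) + C * t ^+ 2.
pose G1 t := - slope 0 (x1 + t *: v1) v1 - slope 0 (x2 + t *: v2) v2
    + slope delta (x3 + t *: v3) v3 + slope delta (x4 + t *: v4) v4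
    + 2 * (psi1 a (p + t * c1) * c1) - 2 * (psi1 a (q + t * c2) * c2) + C * (2 * t).
have lin (r c t : R) : is_derive t 1 (fun t => r + t * c) c.
  apply: is_derive_eq (der_add (der_cst t r) (der_mul (der_id t) (der_cst t c))) _.
  by rewrite add0r mul1r mulr0 addr0.
have dG t : is_derive t 1 G (G1 t).
  have D1 := ln_line x1 v1 t s0 (lexx 0); have D2 := ln_line x2 v2 t s0 (lexx 0).
  have D3 := ln_line x3 v3 t s0 (ltW delta0); have D4 := ln_line x4 v4 t s0 (ltW delta0).
  have D5 := der_mulc 2 (@der_comp _ (psi a) (fun t => p + t * c1) t _ _ (psi_derive a _) (lin p c1 t)).
  have D6 := der_mulc 2 (@der_comp _ (psi a) (fun t => q + t * c2) t _ _ (psi_derive a _) (lin q c2 t)).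
  have D7 : is_derive t 1 (fun t => C * t ^+ 2) (C * (2 * t)).
    apply: der_mulc; apply: is_derive_eq (der_mul (der_id t) (der_id t)) _.
    by rewrite mul1r mulr1 mulr_natl mulr2n.
  exact: der_add (der_sub (der_add (der_add (der_add (der_sub (der_opp D1) D2) D3) D4) D5) D6) D7.
have dG1 : is_derive (0 : R) 1 G1 (- curv 0 x1 v1 - curv 0 x2 v2 + curv delta x3 v3 + curv delta x4 v4
    + 2 * c1 ^+ 2 * psi2 a p - 2 * c2 ^+ 2 * psi2 a q + 2 * C).
  have D1 := ln_line2 x1 v1 s0 (lexx 0); have D2 := ln_line2 x2 v2 s0 (lexx 0).
  have D3 := ln_line2 x3 v3 s0 (ltW delta0); have D4 := ln_line2 x4 v4 s0 (ltW delta0).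
  have E5 := @der_comp _ (psi1 a) (fun t => p + t * c1) 0 _ _ (psi1_derive a _) (lin p c1 0).
  have D5 := der_mulc 2 (der_mul E5 (der_cst 0 c1)).
  have E6 := @der_comp _ (psi1 a) (fun t => q + t * c2) 0 _ _ (psi1_derive a _) (lin q c2 0).
  have D6 := der_mulc 2 (der_mul E6 (der_cst 0 c2)).
  have D7 := der_mulc C (der_mulc 2 (der_id (0 : R))).
  have D := der_add (der_sub (der_add (der_add (der_add (der_sub (der_opp D1) D2) D3) D4) D5) D6) D7.
  apply: is_derive_eq D _; rewrite /curv /slope !mul0r !addr0; ring.
have G0 : G 0 = - ln (u s x1) - ln (u s x2) + ln (u s x3 + delta) + ln (u s x4 + delta)
      + 2 * psi a p - 2 * psi a q.
  by rewrite /G !scale0r !mul0r !addr0 expr0n /= mulr0 addr0.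
have Gm t : `|t| < e0 -> G 0 <= G t.
  by move=> te; rewrite G0; apply: le_trans (Hmin t te) _; rewrite /G !addr0.
split; last by apply: (der2_ge0_min e00 (fun t _ => dG t) dG1).
have := der_eq0_min e00 (dG 0) Gm.
rewrite /G1 /slope !scale0r !mul0r !mulr0 !addr0 => <-; ring.
Qed.

End AtPoint.

(** Let A1, ..., A4 be the gradients of the four logarithms. The summed second-order condition and
    twice the time inequality leave 2 eta <= |A1|^2 + |A2|^2 - |A3|^2 - |A4|^2 + 2 psi2(p) - 2
    psi2(q). As A1 + A2 = A3 + A4, the quadratic terms are half of |A1-A2|^2 - |A3-A4|^2. Their
    components along [e] cancel the [psi2] terms by [psi2E], and the orthogonal parts contribute at
    most 0 because |l| < 1. *)
Lemma no_interior_min s m z l : 0 < s <= T -> z != 0 -> `|l| < 1 -> 0 < eta ->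
  (forall s' m' z' l', 0 <= s' <= T -> `|l'| <= 1 ->
    cfg s m z l + eta * s <= cfg s' m' z' l' + eta * s') -> False.
Proof.
move=> /andP[s0 sT] z0 l1 eta0 Hmin.
have sT' : 0 <= s <= T by rewrite (ltW s0).
pose p := enorm z; pose q := l * p.
have p0 : 0 < p.
  rewrite lt_neqAle enorm_ge0 andbT eq_sym; apply: contra z0 => /eqP h.
  by apply/eqP; exact: enorm_eq0.
have pn0 : p != 0 by rewrite gt_eqF.
have [e [ze e1]] : exists e : 'rV[R]_d, z = p *: e /\ dotp e e = 1.
  exists (p^-1 *: z); split; first by rewrite scalerA divff// scale1r.
  by rewrite !dotpE -sqr_enorm -/p; field.
have lze : l *: z = q *: e by rewrite /q -scalerA -ze.
have enormpe r : 0 < r -> enorm (r *: e) = r.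
  by move=> r0; rewrite enormZ /enorm e1 sqrtr1 mulr1 gtr0_norm.
have qp : `|q| < p by rewrite normrM (gtr0_norm p0) gtr_pMl.
set x1 := m + z; set x2 := m - z; set x3 := m + l *: z; set x4 := m - l *: z.
pose B := - ln (u s x1) - ln (u s x2) + ln (u s x3 + delta) + ln (u s x4 + delta)
      + 2 * psi a p - 2 * psi a q.
(* With the direction [e] fixed, taking l' = q'/p' turns the outer and inner radii into independent
   variables. *)
have minpq m' p' q' : 0 < p' -> `|q'| <= p' -> B <=
    - ln (u s (m' + p' *: e)) - ln (u s (m' - p' *: e))
    + ln (u s (m' + q' *: e) + delta) + ln (u s (m' - q' *: e) + delta)
    + 2 * psi a p' - 2 * psi a q'.
  move=> p'0 q'p'.
  have p'n : p' != 0 by rewrite gt_eqF.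
  have l' : `|q' / p'| <= 1 by rewrite normrM normfV (gtr0_norm p'0) ler_pdivrMr// mul1r.
  have := Hmin s m' (p' *: e) (q' / p') sT' l'.
  by rewrite lerD2r /cfg enormpe// divfK// scalerA divfK// -/p -/q.
pose slope c x v := dotp (N s x) v / (u s x + c).
pose curv c x v := H s x v / (u s x + c) - slope c x v ^+ 2.
have var mu c1 c2 :
  - slope 0 x1 (mu + c1 *: e) - slope 0 x2 (mu - c1 *: e)
    + slope delta x3 (mu + c2 *: e) + slope delta x4 (mu - c2 *: e)
    + 2 * c1 * psi1 a p - 2 * c2 * psi1 a q = 0 /\
  0 <= - curv 0 x1 (mu + c1 *: e) - curv 0 x2 (mu - c1 *: e)
    + curv delta x3 (mu + c2 *: e) + curv delta x4 (mu - c2 *: e)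
    + 2 * c1 ^+ 2 * psi2 a p - 2 * c2 ^+ 2 * psi2 a q + 2 * 0.
  have cc0 : 0 < `|c1| + `|c2| + 1 by rewrite ltr_wpDl// addr_ge0.
  (* The gap between |q| and p leaves room: below this bound on |t|, the moved radii still satisfy
     |q + t c2| <= p + t c1. *)
  apply: (@variation s x1 x2 x3 x4 p q s0 _ _ _ _ c1 c2 0 ((p - `|q|) / (`|c1| + `|c2| + 1))).
    by rewrite divr_gt0// subr_gt0.
  move=> t; rewrite ltr_pdivlMr// => te.
  have t1 : `|t * c1| = `|t| * `|c1| by rewrite normrM.
  have t2 : `|t * c2| = `|t| * `|c2| by rewrite normrM.
  have tn := normr_ge0 t.
  have tc1 : - (`|t| * `|c1|) <= t * c1 by rewrite -t1 lerNl; rewrite -normrN ler_norm.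
  have tc2n : 0 <= `|t| * `|c2| by rewrite mulr_ge0.
  have h2 : `|q + t * c2| <= `|q| + `|t| * `|c2| by rewrite -t2 ler_normD.
  have qn := normr_ge0 q.
  have := minpq (m + t *: mu) (p + t * c1) (q + t * c2).
  rewrite mul0r addr0.
  have -> : m + t *: mu + (p + t * c1) *: e = x1 + t *: (mu + c1 *: e).
    by rewrite /x1 ze scalerDl scalerDr scalerA addrACA.
  have -> : m + t *: mu - (p + t * c1) *: e = x2 + t *: (mu - c1 *: e).
    by rewrite /x2 ze scalerDl scalerBr scalerA opprD addrACA.
  have -> : m + t *: mu + (q + t * c2) *: e = x3 + t *: (mu + c2 *: e).
    by rewrite /x3 lze scalerDl scalerDr scalerA addrACA.
  have -> : m + t *: mu - (q + t * c2) *: e = x4 + t *: (mu - c2 *: e).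
    by rewrite /x4 lze scalerDl scalerBr scalerA opprD addrACA.
  by apply; move: te; rewrite !mulrDr mulr1; lra.
(* [|z + t w| = p + O(t^2)] for [w] orthogonal to [z]; the [O(t^2)] is the slack [C t^2]
   in [variation]. *)
have rot w : dotp w e = 0 ->
  - slope 0 x1 w - slope 0 x2 (- w) + slope delta x3 (l *: w) + slope delta x4 (- (l *: w)) = 0.
  move=> we.
  (* The slack constant: p' - p <= t^2 |w|^2 / (2p) by Pythagoras, and [psi] grows at rate at most
     [a]. The inner radius grows as well, which only lowers the right-hand side. *)
  have [] := @variation s x1 x2 x3 x4 p q s0 w (- w) (l *: w) (- (l *: w)) 0 0 (a * dotp w w / p) 1 ltr01.
    move=> t _; rewrite !mulr0 !addr0.
    pose p' := enorm (z + t *: w).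
    have zw : dotp z w = 0 by rewrite ze dotpZl dotpC we mulr0.
    have p'2 : p' ^+ 2 = p ^+ 2 + t ^+ 2 * dotp w w.
      rewrite !sqr_enorm !dotpE (dotpC w z) zw; ring.
    have ww := dotpp_ge0 w.
    have tww : 0 <= t ^+ 2 * dotp w w by rewrite mulr_ge0 ?sqr_ge0.
    have pp' : p <= p'.
      by rewrite -ler_sqr ?nnegrE ?enorm_ge0 ?(ltW p0)// p'2 lerDl.
    have p'le : p' - p <= t ^+ 2 * dotp w w / (2 * p).
      rewrite ler_pdivlMr ?mulr_gt0//.
      have -> : t ^+ 2 * dotp w w = p' ^+ 2 - p ^+ 2 by rewrite p'2 addrC addKr.
      have := sqr_ge0 (p' - p); rewrite !expr2; lra.
    have := Hmin s m (z + t *: w) l sT' (ltW l1); rewrite lerD2r /cfg -/p -/p' -/q.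
    have -> : m + (z + t *: w) = x1 + t *: w by rewrite addrA.
    have -> : m - (z + t *: w) = x2 + t *: - w by rewrite opprD addrA scalerN.
    have -> : m + l *: (z + t *: w) = x3 + t *: (l *: w).
      by rewrite scalerDr addrA !scalerA (mulrC l).
    have -> : m - l *: (z + t *: w) = x4 + t *: (- (l *: w)).
      by rewrite scalerDr opprD addrA scalerN !scalerA (mulrC l).
    have h1 := psi_lip a0 pp'.
    have h2 : psi a q <= psi a (l * p').
      have : `|q| <= `|l * p'|.
        by rewrite !normrM ler_wpM2l// !ger0_norm ?enorm_ge0.
      by move=> /(psi_le a0); rewrite psi_abs.
    have h3 : a * (p' - p) <= a * (t ^+ 2 * dotp w w / (2 * p)) by rewrite ler_wpM2l ?(ltW a0).
    have h4 : a * dotp w w / p * t ^+ 2 = 2 * (a * (t ^+ 2 * dotp w w / (2 * p))) by field.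
    rewrite h4 -/x1 -/x2 -/x3 -/x4; lra.
  by rewrite !mulr0 !mul0r subr0 addr0.
pose A1 := (u s x1 + 0)^-1 *: N s x1; pose A2 := (u s x2 + 0)^-1 *: N s x2.
pose A3 := (u s x3 + delta)^-1 *: N s x3; pose A4 := (u s x4 + delta)^-1 *: N s x4.
have S1 v : slope 0 x1 v = dotp A1 v by rewrite /A1 dotpZl mulrC.
have S2 v : slope 0 x2 v = dotp A2 v by rewrite /A2 dotpZl mulrC.
have S3 v : slope delta x3 v = dotp A3 v by rewrite /A3 dotpZl mulrC.
have S4 v : slope delta x4 v = dotp A4 v by rewrite /A4 dotpZl mulrC.
have C1 v : dotp A1 v + dotp A2 v = dotp A3 v + dotp A4 v.
  have [] := var v 0 0; rewrite !scale0r !subr0 !addr0 !S1 !S2 !S3 !S4 => h _; lra.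
have C2 : dotp A1 e - dotp A2 e = 2 * psi1 a p.
  have [] := var 0 1 0; rewrite !scale1r !scale0r !subr0 !add0r !S1 !S2 !S3 !S4 dotpNr !dotp0r => h _; lra.
have C3 : dotp A3 e - dotp A4 e = 2 * psi1 a q.
  have [] := var 0 0 1; rewrite !scale1r !scale0r !subr0 !add0r !S1 !S2 !S3 !S4 dotpNr !dotp0r => h _; lra.
have C4 w : dotp w e = 0 -> dotp A1 w - dotp A2 w = l * (dotp A3 w - dotp A4 w).
  by move=> /rot; rewrite S1 S2 S3 S4 !dotpNr !dotpZr; lra.
(* Reflection coupling: [x1], [x3] move along a basis vector and [x2], [x4] along its
   mirror image in the hyperplane orthogonal to [e]. *)
have second i : 0 <= - curv 0 x1 (delta_mx ord0 i) - curv 0 x2 (reflect_dir e i)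
    + curv delta x3 (delta_mx ord0 i) + curv delta x4 (reflect_dir e i)
    + 2 * e ord0 i ^+ 2 * psi2 a p - 2 * e ord0 i ^+ 2 * psi2 a q.
  have [_] := var (delta_mx ord0 i - e ord0 i *: e) (e ord0 i) (e ord0 i).
  rewrite !subrK !mulr0 !addr0.
  suff -> : delta_mx ord0 i - e ord0 i *: e - e ord0 i *: e = reflect_dir e i by [].
  by rewrite /reflect_dir -addrA -opprD -scalerDl mulr_natl mulr2n.
have tot : 0 <= - (Lap s x1 / (u s x1 + 0) - dotp A1 A1) - (Lap s x2 / (u s x2 + 0) - dotp A2 A2)
  + (Lap s x3 / (u s x3 + delta) - dotp A3 A3) + (Lap s x4 / (u s x4 + delta) - dotp A4 A4)
  + 2 * psi2 a p - 2 * psi2 a q.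
  have c1E : \sum_(i < d) curv 0 x1 (delta_mx ord0 i) = Lap s x1 / (u s x1 + 0) - dotp A1 A1.
    rewrite sumrB -mulr_suml sum_H//; [|exact: sum_sqr_delta|exact: sum_dotp_delta].
    by congr (_ - _); rewrite -sum_sqr_delta; apply: eq_bigr => i _; rewrite S1.
  have c2E : \sum_(i < d) curv 0 x2 (reflect_dir e i) = Lap s x2 / (u s x2 + 0) - dotp A2 A2.
    rewrite sumrB -mulr_suml sum_H//; [|exact: sum_sqr_reflect|exact: sum_dotp_reflect].
    by congr (_ - _); rewrite -(sum_sqr_reflect e1); apply: eq_bigr => i _; rewrite S2.
  have c3E : \sum_(i < d) curv delta x3 (delta_mx ord0 i) = Lap s x3 / (u s x3 + delta) - dotp A3 A3.
    rewrite sumrB -mulr_suml sum_H//; [|exact: sum_sqr_delta|exact: sum_dotp_delta].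
    by congr (_ - _); rewrite -sum_sqr_delta; apply: eq_bigr => i _; rewrite S3.
  have c4E : \sum_(i < d) curv delta x4 (reflect_dir e i) = Lap s x4 / (u s x4 + delta) - dotp A4 A4.
    rewrite sumrB -mulr_suml sum_H//; [|exact: sum_sqr_reflect|exact: sum_dotp_reflect].
    by congr (_ - _); rewrite -(sum_sqr_reflect e1); apply: eq_bigr => i _; rewrite S4.
  clearbody curv.
  have : 0 <= \sum_(i < d) (- curv 0 x1 (delta_mx ord0 i) - curv 0 x2 (reflect_dir e i)
    + curv delta x3 (delta_mx ord0 i) + curv delta x4 (reflect_dir e i)
    + 2 * e ord0 i ^+ 2 * psi2 a p - 2 * e ord0 i ^+ 2 * psi2 a q).
    by apply: sumr_ge0 => i _; exact: second.
  rewrite !big_split/= !sumrN -!mulr_suml -!mulr_sumr.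
  have -> : \sum_(i < d) e ord0 i ^+ 2 = 1 by rewrite -e1; apply: eq_bigr => i _; rewrite expr2.
  by rewrite c1E c2E c3E c4E !mulr1.
have time : - (2^-1 * Lap s x1 / (u s x1 + 0)) - 2^-1 * Lap s x2 / (u s x2 + 0)
  + 2^-1 * Lap s x3 / (u s x3 + delta) + 2^-1 * Lap s x4 / (u s x4 + delta) + eta <= 0.
  pose F r := - ln (u r x1 + 0) - ln (u r x2 + 0) + ln (u r x3 + delta) + ln (u r x4 + delta) + eta * r.
  have lnt c x : 0 <= c -> is_derive s 1 (fun r => ln (u r x + c)) (2^-1 * Lap s x / (u s x + c)).
    move=> c0; have D := der_add (u_time x s0) (der_cst s c); rewrite addr0 in D.
    by apply: (@der_ln _ (fun r => u r x + c)) => //; rewrite ltr_pwDl.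
  have dF : is_derive s 1 F (- (2^-1 * Lap s x1 / (u s x1 + 0)) - 2^-1 * Lap s x2 / (u s x2 + 0)
    + 2^-1 * Lap s x3 / (u s x3 + delta) + 2^-1 * Lap s x4 / (u s x4 + delta) + eta).
    have D5 : is_derive s 1 (fun r => eta * r) eta.
      by apply: is_derive_eq (der_mulc eta (der_id s)) _; rewrite mulr1.
    have D := der_add (der_add (der_add (der_sub (der_opp (lnt 0 x1 (lexx 0))) (lnt 0 x2 (lexx 0)))
      (lnt _ x3 (ltW delta0))) (lnt _ x4 (ltW delta0))) D5.
    exact: D.
  apply: (der_le0_leftmin s0 dF) => t /andP[t1 t2].
  have st : 0 <= s + t <= T by apply/andP; split; lra.
  have := Hmin (s + t) m z l st (ltW l1); rewrite /cfg /F !addr0 -/x1 -/x2 -/x3 -/x4; lra.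
clearbody A1 A2 A3 A4.
pose P := A1 - A2; pose Q := A3 - A4.
have sumAB : dotp A1 A1 + dotp A2 A2 - dotp A3 A3 - dotp A4 A4 = 2^-1 * (dotp P P - dotp Q Q).
  have h : dotp (A1 + A2) (A1 + A2) = dotp (A3 + A4) (A3 + A4).
    by rewrite dotpDl !C1 -!dotpDl dotpC dotpDl C1 -dotpDl.
  rewrite /P /Q; move: h; rewrite !dotpE (dotpC A2 A1) (dotpC A4 A3); lra.
have PE : dotp P e = 2 * psi1 a p by rewrite dotpBl.
have QE : dotp Q e = 2 * psi1 a q by rewrite dotpBl.
pose Pt := P - dotp P e *: e; pose Qt := Q - dotp Q e *: e.
have Pte : dotp Pt e = 0 by rewrite dotpBl dotpZl e1 mulr1 subrr.
have Qte : dotp Qt e = 0 by rewrite dotpBl dotpZl e1 mulr1 subrr.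
have PQ w : dotp w e = 0 -> dotp Pt w = l * dotp Qt w.
  move=> we; rewrite /Pt /Qt !dotpBl !dotpZl (dotpC e w) we !mulr0 !subr0.
  by rewrite /P /Q ?dotpBl C4.
have PP : dotp Pt Pt = l ^+ 2 * dotp Qt Qt.
  by rewrite PQ// dotpC PQ// mulrA expr2.
have pyth V : dotp V V = dotp V e ^+ 2 + dotp (V - dotp V e *: e) (V - dotp V e *: e).
  by rewrite !dotpBl !dotpBr !dotpZl !dotpZr e1 (dotpC e V); ring.
have dP : dotp P P = dotp P e ^+ 2 + dotp Pt Pt by exact: pyth.
have dQ : dotp Q Q = dotp Q e ^+ 2 + dotp Qt Qt by exact: pyth.
have Qt0 := dotpp_ge0 Qt.
have le : dotp Pt Pt <= dotp Qt Qt.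
  rewrite PP ler_piMl// -real_normK ?num_real//.
  by rewrite exprn_ile1// ltW.
have k1 := psi2E a p; have k2 := psi2E a q.
have e4 : (2 * psi1 a p) ^+ 2 = 4 * psi1 a p ^+ 2 by ring.
have e5 : (2 * psi1 a q) ^+ 2 = 4 * psi1 a q ^+ 2 by ring.
move: dP dQ; rewrite PE QE e4 e5 => dP dQ.
lra.
Qed.

End InteriorMinimum.

Section MaximumPrinciple.
Variables (R : realType) (d : nat) (a delta T K : R).
Variables (u : R -> 'rV[R]_d -> R) (N : R -> 'rV[R]_d -> 'rV[R]_d).
Variables (H : R -> 'rV[R]_d -> 'rV[R]_d -> R) (Lap : R -> 'rV[R]_d -> R).
Implicit Types (t s l : R) (m x z v w : 'rV[R]_d).

Hypotheses (a0 : 0 < a) (delta0 : 0 < delta).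
Hypothesis u_gt0 : forall s x, 0 < u s x.
Hypothesis u_line : forall s x v t, 0 < s ->
  is_derive t 1 (fun t => u s (x + t *: v)) (dotp (N s (x + t *: v)) v).
Hypothesis N_line : forall s x v, 0 < s ->
  is_derive (0 : R) 1 (fun t : R => dotp (N s (x + t *: v)) v) (H s x v).
Hypothesis sum_H : forall s x (v : 'I_d -> 'rV[R]_d), 0 < s ->
  (forall w, \sum_(i < d) dotp w (v i) ^+ 2 = dotp w w) ->
  \sum_(i < d) dotp (v i) (v i) = d%:R ->
  \sum_(i < d) H s x (v i) = Lap s x.
Hypothesis u_time : forall s x, 0 < s ->
  is_derive s 1 (fun t => u t x) (2^-1 * Lap s x).
Hypothesis u_cont : continuous (fun p : R * 'rV[R]_d => u p.1 p.2).
Hypothesis u_decay : forall s x, 0 <= s <= T -> u s x * (1 + dotp x x) <= K.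
Hypothesis u_init : forall m z l, `|l| <= 1 ->
  0 <= - ln (u 0 (m + z)) - ln (u 0 (m - z))
       + ln (u 0 (m + l *: z)) + ln (u 0 (m - l *: z))
       + 2 * psi a (enorm z) - 2 * psi a (l * enorm z).

Local Notation gap := (cfg a delta u).

Lemma ln_le_delta s x : ln (u s x) <= ln (u s x + delta).
Proof. by rewrite ler_ln ?posrE ?addr_gt0// lerDl ltW. Qed.

Lemma ln_delta_le s x : ln delta <= ln (u s x + delta).
Proof. by rewrite ler_ln ?posrE ?addr_gt0// lerDr ltW. Qed.

Lemma psi_cfg z l : `|l| <= 1 -> psi a (l * enorm z) <= psi a (enorm z).
Proof.
move=> l1; apply: psi_le => //; rewrite normrM (ger0_norm (enorm_ge0 z)).
by rewrite ler_piMl ?enorm_ge0.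
Qed.

(** One outer value is at most K/(1+rho) and the other at most K, so their product is at most
    delta^2, while each inner logarithm is at least ln delta. *)
Lemma cfg_far s m z l (rho : R) : 0 <= s <= T -> `|l| <= 1 -> 0 <= rho ->
  K ^+ 2 <= delta ^+ 2 * (1 + rho) ->
  rho <= dotp (m + z) (m + z) \/ rho <= dotp (m - z) (m - z) -> 0 <= gap s m z l.
Proof.
move=> sT l1 r0 Kr far.
have u12 : u s (m + z) * u s (m - z) <= delta ^+ 2.
  have r1 : 0 < 1 + rho by rewrite ltr_pwDl.
  rewrite -(ler_pM2r r1); apply: le_trans Kr.
  have one x : u s x <= K.
    apply: le_trans (u_decay x sT); rewrite ler_peMr ?(ltW (u_gt0 _ _))//.
    by rewrite lerDl dotpp_ge0.
  have two x : rho <= dotp x x -> u s x * (1 + rho) <= K.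
    move=> rx; apply: le_trans (u_decay x sT).
    by rewrite ler_wpM2l ?lerD2l// ltW.
  have r10 := ltW r1.
  rewrite expr2; case: far => /two h.
    rewrite mulrAC; apply: ler_pM => //; rewrite ?mulr_ge0// ltW//.
  rewrite -mulrA; apply: ler_pM => //; rewrite ?mulr_ge0// ltW//.
have h1 : ln (u s (m + z)) + ln (u s (m - z)) <= 2 * ln delta.
  rewrite -lnM ?posrE// mulr_natl -lnXn// ler_ln ?posrE ?mulr_gt0// exprn_gt0//.
have h2 := ln_delta_le s (m + l *: z); have h3 := ln_delta_le s (m - l *: z).
have h4 := psi_cfg z l1.
rewrite /cfg; lra.
Qed.

Lemma continuous_u_comp (X : topologicalType) (f : X -> R) (g : X -> 'rV[R]_d) :
  continuous f -> continuous g -> continuous (fun p => u (f p) (g p)).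
Proof.
move=> cf cg p.
apply: (@cvg_comp _ _ _ (fun p => (f p, g p)) (fun q => u q.1 q.2) (nbhs p) (nbhs (f p, g p))).
  exact: (@cvg_pair _ _ _ (nbhs p) (nbhs (f p)) (nbhs (g p)) _ _ _ f g (cf p) (cg p)).
exact: (@u_cont (f p, g p)).
Qed.

Lemma continuous_cfg (X : topologicalType) (s l : X -> R) (m z : X -> 'rV[R]_d) :
  continuous s -> continuous l -> continuous m -> continuous z ->
  continuous (fun p => gap (s p) (m p) (z p) (l p)).
Proof.
move=> cs cl cm cz.
have cz2 : continuous (fun p => enorm (z p)).
  move=> p; apply: (@cvg_comp _ _ _ z (@enorm R d) (nbhs p) (nbhs (z p)) _ (cz p)).
  exact: continuous_enorm.
have clz : continuous (fun p => l p *: z p) by move=> p; apply: cvgZ; [exact: cl|exact: cz].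
have cA (f g : X -> 'rV[R]_d) : continuous f -> continuous g -> continuous (fun p => f p + g p).
  by move=> cf cg p; apply: cvgD; [exact: cf|exact: cg].
have cN (f : X -> 'rV[R]_d) : continuous f -> continuous (fun p => - f p).
  by move=> cf p; apply: cvgN; exact: cf.
have cpsi f : continuous f -> continuous (fun p : X => 2 * psi a (f p)).
  move=> cf; apply: continuous_mul; first exact: continuous_cst.
  by apply: continuous_comp_real => //; exact: psi_continuous.
have c0 g : continuous g -> continuous (fun p => - ln (u (s p) (g p))).
  move=> cg; apply: continuous_opp; apply: continuous_ln_comp => //.
  exact: continuous_u_comp.
have cd g : continuous g -> continuous (fun p => ln (u (s p) (g p) + delta)).
  move=> cg; apply: continuous_ln_comp; first by move=> p; rewrite addr_gt0.
  by apply: continuous_add; [exact: continuous_u_comp|exact: continuous_cst].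
apply: continuous_add; last first.
  by apply: continuous_opp; apply: cpsi; exact: continuous_mul.
apply: continuous_add; last exact: cpsi.
apply: continuous_add; last by apply: cd; apply: cA => //; exact: cN.
apply: continuous_add; last by apply: cd; exact: cA.
by apply: continuous_add; apply: c0; apply: cA => //; exact: cN.
Qed.

Theorem cfg_ge0 s m z l : 0 <= s <= T -> `|l| <= 1 -> 0 <= gap s m z l.
Proof.
move=> sT l1; rewrite leNgt; apply/negP => neg.
have T0 : 0 <= T by case/andP: sT => h1 h2; exact: le_trans h2.
(* Over the whole time interval eta * s uses up less than half of the negative value, so [Psi] stays
   negative there. *)
pose eta := - gap s m z l / (2 * (T + 1)).
have T1 : 0 < 2 * (T + 1) by rewrite mulr_gt0// ltr_wpDl.
have eta0 : 0 < eta by rewrite divr_gt0// oppr_gt0.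
pose Psi s m z l := gap s m z l + eta * s.
have Pneg : Psi s m z l < 0.
  have : eta * s <= eta * T by rewrite ler_wpM2l ?(ltW eta0)//; case/andP: sT.
  have : eta * (2 * (T + 1)) = - gap s m z l by rewrite divfK// gt_eqF.
  have := mulr_ge0 (ltW eta0) T0; rewrite /Psi; lra.
pose rho := (K / delta) ^+ 2.
have rho0 : 0 <= rho by rewrite sqr_ge0.
have Krho : K ^+ 2 <= delta ^+ 2 * (1 + rho).
  rewrite mulrDr mulr1 /rho exprMn exprVn mulrCA divff ?mulr1; last by rewrite expf_neq0// gt_eqF.
  by rewrite lerDr sqr_ge0.
(* A vector outside the box [M] has a coordinate larger than [r] in absolute value; rho + 1 gives
   rho <= r^2 without a square root. *)
pose r := rho + 1.
have rrho : rho <= r ^+ 2.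
  by rewrite /r expr2; have := mulr_ge0 rho0 rho0; lra.
pose M := [set v : 'rV[R]_d | forall i, `[- r, r]%classic (v ord0 i)].
have cM : compact M by apply: (@rV_compact _ _ (fun=> `[- r, r]%classic)) => i; exact: segment_compact.
have notM v : ~ M v -> rho <= dotp v v.
  move=> nM; rewrite leNgt; apply/negP => vr; apply: nM => i /=.
  rewrite in_itv /= -ler_norml.
  have r0 : 0 <= r by rewrite /r addr_ge0.
  rewrite -ler_sqr ?nnegrE// real_normK ?num_real//.
  by apply: le_trans (sqr_coord_le v i) _; rewrite (le_trans (ltW vr)).
have PsiM s' m' z' l' : 0 <= s' <= T -> `|l'| <= 1 -> ~ (M m' /\ M z') -> 0 <= Psi s' m' z' l'.
  move=> sT' l1' nM; rewrite /Psi addr_ge0//; last first.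
    by rewrite mulr_ge0 ?(ltW eta0)//; case/andP: sT'.
  (* Parallelogram identity: if m' or z' is large, so is one of m' + z' and m' - z', as [cfg_far]
     requires. *)
  have mz : dotp (m' + z') (m' + z') + dotp (m' - z') (m' - z') = 2 * dotp m' m' + 2 * dotp z' z'.
    by rewrite !dotpE; ring.
  have m0 := dotpp_ge0 m'; have z0 := dotpp_ge0 z'.
  apply: (@cfg_far _ _ _ _ rho) => //.
  have : rho <= dotp m' m' \/ rho <= dotp z' z'.
    have [Mm|/notM ?] := pselect (M m'); last by left.
    by right; apply: notM => Mz; apply: nM.
  by have [|] := leP rho (dotp (m' + z') (m' + z')); [left|right; lra].
pose A : set (R * 'rV[R]_d * 'rV[R]_d * R) := ((`[0, T]%classic `*` M) `*` M) `*` `[-1, 1]%classic.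
have cA : compact A.
  apply: compact_setX; last exact: segment_compact.
  apply: compact_setX => //; apply: compact_setX => //; exact: segment_compact.
have MM : M m /\ M z.
  by apply: contrapT => nM; have := PsiM _ _ _ _ sT l1 nM; rewrite leNgt Pneg.
have A0 : A !=set0.
  exists (s, m, z, l); split => /=; last by rewrite in_itv /= -ler_norml.
  by case: MM => ? ?; split => //; split => //=; rewrite in_itv.
pose f (p : R * 'rV[R]_d * 'rV[R]_d * R) := Psi p.1.1.1 p.1.1.2 p.1.2 p.2.
have cf : continuous f.
  have c1 : continuous (fun p : R * 'rV[R]_d * 'rV[R]_d * R => p.1) by move=> p; exact: cvg_fst.
  have c11 : continuous (fun p : R * 'rV[R]_d * 'rV[R]_d * R => p.1.1).
    by move=> p; apply: (@cvg_comp _ _ _ (fun p => p.1) fst (nbhs p) (nbhs p.1) _ (c1 p)); exact: cvg_fst.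
  have c12 : continuous (fun p : R * 'rV[R]_d * 'rV[R]_d * R => p.1.2).
    by move=> p; apply: (@cvg_comp _ _ _ (fun p => p.1) snd (nbhs p) (nbhs p.1) _ (c1 p)); exact: cvg_snd.
  have c111 : continuous (fun p : R * 'rV[R]_d * 'rV[R]_d * R => p.1.1.1).
    by move=> p; apply: (@cvg_comp _ _ _ (fun p => p.1.1) fst (nbhs p) (nbhs p.1.1) _ (c11 p)); exact: cvg_fst.
  have c112 : continuous (fun p : R * 'rV[R]_d * 'rV[R]_d * R => p.1.1.2).
    by move=> p; apply: (@cvg_comp _ _ _ (fun p => p.1.1) snd (nbhs p) (nbhs p.1.1) _ (c11 p)); exact: cvg_snd.
  have c2 : continuous (fun p : R * 'rV[R]_d * 'rV[R]_d * R => p.2) by move=> p; exact: cvg_snd.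
  apply: continuous_add; first exact: continuous_cfg.
  by apply: continuous_mul => //; exact: continuous_cst.
have [[[[s1 m1] z1] l1'] Ac fmin] := compact_EVT_min A0 cA (continuous_subspaceT cf).
move: Ac; rewrite inE => -[[[/= s1T M1] M2]]; rewrite /= !in_itv /= in s1T *; move=> l1T.
rewrite -ler_norml in l1T.
have inA s' m' z' l' : 0 <= s' <= T -> `|l'| <= 1 -> M m' -> M z' -> Psi s1 m1 z1 l1' <= Psi s' m' z' l'.
  move=> h1 h2 h3 h4; apply: (fmin (s', m', z', l')); rewrite inE; split => /=; last by rewrite in_itv /= -ler_norml.
  by split => //; split => //=; rewrite in_itv.
have neg1 : Psi s1 m1 z1 l1' < 0 by case: MM => ? ?; apply: le_lt_trans Pneg; exact: inA.
have glob s' m' z' l' : 0 <= s' <= T -> `|l'| <= 1 -> Psi s1 m1 z1 l1' <= Psi s' m' z' l'.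
  move=> h1 h2; have [[? ?]|nM] := pselect (M m' /\ M z'); first exact: inA.
  by apply: ltW; apply: lt_le_trans neg1 _; exact: PsiM.
have etas : 0 <= eta * s1 by rewrite mulr_ge0 ?(ltW eta0)//; case/andP: s1T.
have cneg : gap s1 m1 z1 l1' < 0 by move: neg1; rewrite /Psi; lra.
(* The minimum avoids the remaining faces: at time zero by the initial inequality; for z = 0 or |l|
   = 1 because the inner and outer pairs coincide and the shift by [delta] decides the sign. *)
have s1n0 : s1 != 0.
  apply/eqP => s10; move: cneg; rewrite s10 ltNge => /negP; apply.
  have := u_init m1 z1 l1T; rewrite /cfg.
  have := ln_le_delta 0 (m1 + l1' *: z1); have := ln_le_delta 0 (m1 - l1' *: z1); lra.
have z1n0 : z1 != 0.
  apply/eqP => z10; move: cneg; rewrite z10 ltNge => /negP; apply.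
  rewrite /cfg scaler0 oppr0 !addr0 {2}/enorm dotp0l sqrtr0 mulr0.
  by have := ln_le_delta s1 m1; rewrite /enorm dotp0l sqrtr0; lra.
have l1n : `|l1'| < 1.
  rewrite lt_neqAle l1T andbT; apply/eqP => l1e; move: cneg; rewrite ltNge => /negP; apply.
  have p1 : psi a (l1' * enorm z1) = psi a (enorm z1).
    by rewrite -psi_abs normrM l1e mul1r (ger0_norm (enorm_ge0 _)).
  have h1 := ln_le_delta s1 (m1 + z1); have h2 := ln_le_delta s1 (m1 - z1).
  rewrite /cfg p1; have [l0|l0] := ger0P l1'.
    move: l1e; rewrite ger0_norm// => ->; rewrite !scale1r; lra.
  have -> : l1' = -1 by move: l1e; rewrite ltr0_norm//; lra.
  rewrite !scaleN1r opprK; lra.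
apply: (@no_interior_min R d a delta eta T u N H Lap a0 delta0 u_gt0 u_line N_line sum_H u_time
  s1 m1 z1 l1') => //.
by case/andP: s1T => h1 ->; rewrite lt_neqAle h1 eq_sym s1n0.
Qed.

End MaximumPrinciple.

(** * Two-point and four-point forms of the class F_L *)

Section LineDerivative.
Variables (R : realType) (d : nat).
Implicit Types (U : 'rV[R]_d -> R) (x y v m z : 'rV[R]_d).

Lemma dotp_grad U x v : dotp (grad U x) v = 'd U x v.
Proof.
rewrite [v in RHS](_ : v = \sum_(i < d) v ord0 i *: delta_mx ord0 i); last first.
  by rewrite [LHS]matrix_sum_delta big_ord1.
rewrite linear_sum; apply: eq_bigr => i _.
by rewrite linearZ mxE mulrC.
Qed.

Lemma dotp_grad_derive U x v : differentiable U x -> dotp (grad U x) v = 'D_v U x.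
Proof. by move=> dU; rewrite dotp_grad; symmetry; exact: deriveE. Qed.

Lemma grad_line U x v (t : R) : differentiable U (x + t *: v) ->
  is_derive t 1 (fun t => U (x + t *: v)) (dotp (grad U (x + t *: v)) v).
Proof.
move=> dU; apply: der_unshift.
have -> : (fun s : R => U (x + (t + s) *: v)) = (fun s : R => U (s *: v + (x + t *: v))).
  by apply/funext => s; rewrite scalerDl addrA addrC.
have D : derivable U (x + t *: v) v by exact: diff_derivable.
have cv : s^-1 *: (U ((s *: 1 + 0) *: v + (x + t *: v)) - U (0 *: v + (x + t *: v))) @[s --> (0:R)^']
    --> 'D_v U (x + t *: v).
  rewrite (_ : (fun s => _) = (fun s => s^-1 *: ((U \o shift (x + t *: v)) (s *: v) - U (x + t *: v)))); last first.
    by apply/funext => s /=; rewrite addr0 scale0r add0r [s *: 1]mulr1.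
  exact: D.
rewrite (dotp_grad_derive v dU); apply: DeriveDef; last exact: cvg_lim cv.
by apply/cvg_ex; exists ('D_v U (x + t *: v)).
Qed.

End LineDerivative.

Section TwoPoint.
Variables (R : realType) (d : nat) (L : R).
Variables (U : 'rV[R]_d -> R) (G : 'rV[R]_d -> 'rV[R]_d).
Hypothesis L0 : 0 < L.
Hypothesis U_line : forall (x v : 'rV[R]_d) (t : R),
  is_derive t 1 (fun t => U (x + t *: v)) (dotp (G (x + t *: v)) v).
Implicit Types (x y v m z : 'rV[R]_d) (l t : R).

Local Notation a := (Num.sqrt L).
Let a0 : 0 < a. Proof. by rewrite sqrtr_gt0. Qed.

Definition twopt := forall m z,
  - (2 * enorm z * psi1 a (enorm z)) <= dotp (G (m + z)) z - dotp (G (m - z)) z.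

Definition fourpt := forall m z l, `|l| <= 1 ->
  0 <= U (m + z) + U (m - z) - U (m + l *: z) - U (m - l *: z)
       + 2 * psi a (enorm z) - 2 * psi a (l * enorm z).

Lemma fL_psi1 (p : R) : fL L (2 * p) = 2 * psi1 a p.
Proof. by rewrite /fL /psi1 mulrA; congr (_ * tanh _); field. Qed.

(** Midpoint coordinates x = m + z, y = m - z, with r = 2|z|. The infimum is [kappa] written out for
    a field [G], so it matches [FL] by conversion when [G] is a gradient. *)
Lemma kappa_twoptP :
  (forall r : R, 0 < r -> ((- (r^-1 * fL L r))%:E <= ereal_inf [set v | exists x y : 'rV[R]_d, enorm (x - y) = r /\
     v = ((enorm (x - y)) ^- 2 * dotp (G x - G y) (x - y))%:E])%E) <-> twopt.
Proof.
split=> [H m z|H r r0].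
  have [z0|z0] := eqVneq z 0.
    have dz v : dotp v z = 0 by rewrite z0 dotp0r.
    by rewrite !dz /enorm dz sqrtr0 mulr0 mul0r subrr oppr0.
  have p0 : 0 < enorm z.
    rewrite lt_neqAle enorm_ge0 andbT eq_sym; apply: contra z0 => /eqP h.
    by apply/eqP; exact: enorm_eq0.
  have E : (m + z) - (m - z) = 2 *: z.
    by apply/rowP => i; rewrite !mxE; ring.
  have nE : enorm ((m + z) - (m - z)) = 2 * enorm z by rewrite E enormZ ger0_norm.
  have r0 : 0 < 2 * enorm z by rewrite mulr_gt0.
  have := H _ r0; move=> /ereal_infP/(_ _ (ex_intro _ _ (ex_intro _ _ (conj nE erefl)))).
  rewrite lee_fin nE E fL_psi1 dotpBl !dotpZr -mulrBr.
  set D := _ - _ => h.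
  have := ler_wpM2l (ltW (mulr_gt0 r0 p0)) h.
  set P := psi1 _ _; move: p0; move: (enorm z) => p p0.
  have -> : 2 * p * p * - ((2 * p)^-1 * (2 * P)) = - (2 * p * P) by field; rewrite gt_eqF.
  by have -> : 2 * p * p * ((2 * p) ^- 2 * (2 * D)) = D by field; rewrite gt_eqF.
apply/ereal_infP => _ [x [y [xy ->]]]; rewrite lee_fin xy.
pose m := 2^-1 *: (x + y); pose z := 2^-1 *: (x - y).
have xE : x = m + z by apply/rowP => i; rewrite !mxE; field.
have yE : y = m - z by apply/rowP => i; rewrite !mxE; field.
have zr : r = 2 * enorm z by rewrite -xy /z enormZ ger0_norm ?invr_ge0// mulrA divff// mul1r.
have xyz : x - y = 2 *: z by rewrite /z scalerA divff// scale1r.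
clearbody m z.
have := H m z; rewrite -xE -yE xyz dotpBl !dotpZr -mulrBr zr fL_psi1.
have p0 : 0 < enorm z by move: r0; rewrite zr pmulr_rgt0.
move: p0; move: (enorm z) => p p0; set P := psi1 _ _; set D := _ - _ => h.
have k0 : 0 <= (2 * p) ^- 2 * 2 by rewrite mulr_ge0// invr_ge0 sqr_ge0.
have := ler_wpM2l k0 h.
have -> : (2 * p) ^- 2 * 2 * - (2 * p * P) = - ((2 * p)^-1 * (2 * P)) by field; rewrite gt_eqF.
by move=> hh; apply: le_trans hh _; rewrite mulrA.
Qed.

(** The two-point inequality says that this even function has nonnegative derivative for t > 0, the
    four-point one that on [-1,1] it is largest at t = 1. *)
Let phi m z (t : R) := U (m + t *: z) + U (m - t *: z) + 2 * psi a (t * enorm z).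

Lemma phi_derive m z (t : R) :
  is_derive t 1 (phi m z)
   (dotp (G (m + t *: z)) z - dotp (G (m - t *: z)) z
     + 2 * (psi1 a (t * enorm z) * enorm z)).
Proof.
have D1 := U_line m z t.
have D2 : is_derive t 1 (fun t => U (m - t *: z)) (- dotp (G (m - t *: z)) z).
  have := U_line m (- z) t; rewrite dotpNr scalerN.
  by congr is_derive; apply/funext => r; rewrite scalerN.
have D3 : is_derive t 1 (fun t => t * enorm z) (enorm z).
  by apply: is_derive_eq (der_mul (der_id t) (der_cst t _)) _; rewrite mul1r mulr0 addr0.
have D4 := der_mulc 2 (@der_comp _ (psi a) (fun t => t * enorm z) t _ _ (psi_derive a _) D3).
exact: (der_add (der_add D1 D2) D4).
Qed.

Lemma twopt_fourpt : twopt -> fourpt.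
Proof.
move=> H m z l l1.
have p0 := enorm_ge0 z.
have phil : phi m z l = phi m z `|l|.
  have [//|_] := ger0P l.
  by rewrite /phi scaleNr opprK mulNr psi_even (addrC (U (m + _))).
have mono : phi m z `|l| <= phi m z 1.
  have [->//|ln1] := eqVneq `|l| 1.
  have lt1 : `|l| < 1 by rewrite lt_neqAle ln1.
  have [|c] := @MVT R (phi m z) _ `|l| 1 lt1 (fun t _ => phi_derive m z t).
    by apply: derivable_within_continuous => x _; have [] := phi_derive m z x.
  rewrite in_itv /= => /andP[lc c1] E.
  rewrite -subr_ge0 E mulr_ge0//; last by rewrite subr_ge0.
  have c0 : 0 < c by rewrite (le_lt_trans _ lc).
  have := H m (c *: z); rewrite enormZ (gtr0_norm c0) !dotpZr -mulrBr.
  set D := dotp _ _ - dotp _ _; set P := psi1 _ _ => h.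
  rewrite -(pmulr_rge0 _ c0) mulrDr; lra.
move: mono; rewrite -phil /phi scale1r mul1r; lra.
Qed.

Lemma fourpt_twopt : fourpt -> twopt.
Proof.
move=> H m z.
have D := der_opp (phi_derive m z 1).
have : - (dotp (G (m + 1 *: z)) z - dotp (G (m - 1 *: z)) z +
    2 * (psi1 a (1 * enorm z) * enorm z)) <= 0.
  apply: (der_le0_leftmin ltr01 D) => t /andP[t1 t2].
  have l1 : `|1 + t| <= 1 by rewrite ger0_norm; lra.
  by have := H m z _ l1; rewrite /phi scale1r mul1r; lra.
rewrite scale1r mul1r; lra.
Qed.

(** As tanh <= 1, the slope along the ray from 0 through y drops by at most 2a|y|. This linear lower
    bound makes exp(-g) grow more slowly than every Gaussian, so its heat flow is finite. *)
Lemma twopt_lower_bound : twopt ->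
  forall y, U 0 + dotp (G 0) y - 2 * a * enorm y <= U y.
Proof.
move=> H y.
have D t : is_derive t 1 (fun t => U (0 + t *: y)) (dotp (G (0 + t *: y)) y).
  exact: U_line.
have [c] : exists2 c, c \in `]0, 1[%R & U (0 + 1 *: y) - U (0 + 0 *: y) = dotp (G (0 + c *: y)) y * (1 - 0).
  apply: (@MVT _ (fun t => U (0 + t *: y))) => //.
  by apply: derivable_within_continuous => x _; have [] := D x.
rewrite in_itv /= => /andP[c0 c1]; rewrite !add0r scale1r scale0r subr0 mulr1 => E.
(* With m = z the two points are c y and 0. *)
have := H ((c / 2) *: y) ((c / 2) *: y).
have c2 : 0 < c / 2 by rewrite divr_gt0.
rewrite subrr -scalerDl -splitr enormZ (gtr0_norm c2) !dotpZr -mulrBr.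
have : psi1 a (c / 2 * enorm y) <= a by rewrite /psi1 ler_piMr ?(ltW a0)// tanh_le1.
set P := psi1 _ _ => Pa h.
have h2 : - (2 * enorm y * P) <= dotp (G (c *: y)) y - dotp (G 0) y.
  by rewrite -(ler_pM2l c2); apply: le_trans h; rewrite le_eqVlt; apply/orP; left; apply/eqP; ring.
have : enorm y * P <= enorm y * a by rewrite ler_wpM2l ?enorm_ge0.
lra.
Qed.

End TwoPoint.

(** * Potentials of the heat flow *)

Section QuadraticDifferentiable.
Variables (R : realType) (d : nat).
(** A named function that can carry the linear structure expected of a differential. *)
Definition dotpl (b v : 'rV[R]_d) : R := dotp b v.
Lemma dotpl_linear b : linear (dotpl b).
Proof. by move=> k x y; rewrite /dotpl dotpDr dotpZr. Qed.
HB.instance Definition _ b := GRing.isLinear.Build R 'rV[R]_d R *:%R (dotpl b) (@dotpl_linear b).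
Lemma differentiable_quad (f : 'rV[R]_d -> R) (x b : 'rV[R]_d) (C e : R) : 0 < e ->
  (forall v : 'rV[R]_d, `|v| <= e -> `|f (x + v) - f x - dotp b v| <= C * `|v| ^+ 2) ->
  differentiable f x.
Proof.
move=> e0 H.
have dc : continuous (dotpl b).
  by case: (@sgrow_dotpr R d b).
have o : (f : _ -> R^o) \o shift x = (cst (f x) : 'rV[R]_d -> R^o) + (dotpl b : _ -> R^o) +o_ (0 : 'rV[R]_d) id.
  apply/eqaddoP => eps eps0.
  have near0 (r : R) : 0 < r -> \forall v \near nbhs (0 : 'rV[R]_d), `|v| <= r.
    move=> r0; apply/nbhs_ballP; exists r => //= v.
    by rewrite -ball_normE /= sub0r normrN => /ltW.
  have eC : 0 < eps / (`|C| + 1) by rewrite divr_gt0// ltr_wpDl.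
  near=> v.
  have -> : ((f : _ -> R^o) \o shift x - ((cst (f x) : 'rV[R]_d -> R^o) + (dotpl b : _ -> R^o))) v = f (x + v) - f x - dotp b v.
    by rewrite !fctE /= opprD addrA (addrC v).
  have ve : `|v| <= e by near: v; exact: near0.
  apply: le_trans (H v ve) _.
  have vC : `|v| <= eps / (`|C| + 1) by near: v; exact: near0.
  rewrite expr2 mulrA ler_wpM2r//.
  apply: le_trans (_ : (`|C| + 1) * `|v| <= _).
    rewrite ler_wpM2r//; have := ler_norm C; lra.
  by rewrite mulrC -ler_pdivlMr// ltr_wpDl.
apply/diff_locallyP.
rewrite (diff_unique dc o).
by split.
Unshelve. all: end_near. Qed.
End QuadraticDifferentiable.

Section HeatPotential.
Variables (R : realType) (d : nat) (h : 'rV[R]_d -> R).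
Hypothesis sh : sgrow h.
Hypothesis h_gt0 : forall y, 0 < h y.
Implicit Types (s t : R) (x v : 'rV[R]_d).

Definition hpot s x : R := - ln (heat h s x).

Lemma heat_differentiable s x : 0 < s -> differentiable (heat h s) x.
Proof.
move=> s0; have [C [e [C0 e0 H]]] := heat_shift sh x s0.
exact: (differentiable_quad e0 H).
Qed.

Lemma hpot_differentiable s x : 0 < s -> differentiable (hpot s) x.
Proof.
move=> s0; apply: (@differentiableN _ _ _ (fun x => ln (heat h s x))).
apply: (@differentiable_comp _ _ _ _ (heat h s) (@ln R)); first exact: heat_differentiable.
apply/derivable1_diffP.
by have [] := is_derive1_ln (heat_gt0 sh s x h_gt0).
Qed.

Definition hpot_grad s x : 'rV[R]_d := (- (heat h s x)^-1) *: hgrad h s x.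

Lemma hpot_line s x v t : 0 < s ->
  is_derive t 1 (fun t => hpot s (x + t *: v)) (dotp (hpot_grad s (x + t *: v)) v).
Proof.
move=> s0.
have D := der_opp (@der_ln _ (fun t => heat h s (x + t *: v)) t _ (heat_gt0 sh s _ h_gt0) (heat_line sh x v t s0)).
apply: is_derive_eq D _.
by rewrite /hpot_grad dotpZl mulNr mulrC.
Qed.

Lemma grad_hpot s : 0 < s -> grad (hpot s) = hpot_grad s.
Proof.
move=> s0; apply/funext => x; apply/rowP => i.
have [_ D1] := hpot_line x (delta_mx ord0 i) 0 s0.
have [_ D2] := @grad_line R d (hpot s) x (delta_mx ord0 i) 0 (hpot_differentiable _ s0).
move: D2; rewrite D1 scale0r addr0 !dotp_delta.
by move=> ->.
Qed.

Lemma heat_continuous_space s : 0 < s -> continuous (heat h s).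
Proof. by move=> s0 x; apply: differentiable_continuous; exact: heat_differentiable. Qed.

Lemma C1_hpot s : 0 < s -> C1 (hpot s).
Proof.
move=> s0; split; first by move=> x; exact: hpot_differentiable.
have ci : continuous (fun x => - (heat h s x)^-1).
  apply: continuous_opp => x.
  have n0 : heat h s x != 0 by rewrite gt_eqF// heat_gt0.
  apply: (@cvg_comp _ _ _ (heat h s) (fun r => r^-1) (nbhs x) (nbhs (heat h s x))).
    exact: heat_continuous_space.
  exact: (der_continuous (der_inv n0 (der_id (heat h s x)))).
rewrite grad_hpot// => x; apply: (@cvgZ _ _ _ (nbhs x)); first exact: ci.
exact: hgrad_continuous.
Qed.

End HeatPotential.

(** * Gaussian cutoff of the data and its removal *)

Section Cutoff.
Variables (R : realType) (d : nat) (h : 'rV[R]_d -> R).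
Hypothesis sh : sgrow h.
Hypothesis h_gt0 : forall y, 0 < h y.
Implicit Types (s t eps : R) (x y : 'rV[R]_d).

Definition cutoff eps y : R := h y * expR (- eps * dotp y y).

Lemma cutoff_gt0 eps y : 0 < cutoff eps y.
Proof. by rewrite mulr_gt0 ?expR_gt0. Qed.

Lemma cutoff_le eps y : 0 <= eps -> cutoff eps y <= h y.
Proof.
move=> e0; rewrite ler_piMr ?(ltW (h_gt0 y))// -[leRHS]expR0 ler_expR.
by rewrite mulNr oppr_le0 mulr_ge0 ?dotpp_ge0.
Qed.

Lemma sgrow_cutoff eps : 0 <= eps -> sgrow (cutoff eps).
Proof.
move=> e0; split.
  apply: continuous_mul; first by case: sh.
  apply: (continuous_comp_real (@continuous_expR R)); apply: continuous_mul; first exact: continuous_cst.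
  by case: (@sgrow_dotpp R d).
case: sh => _ H c /H[C C0 HC]; exists C => // y; apply: le_trans (HC y).
by rewrite !ger0_norm ?(ltW (h_gt0 _)) ?(ltW (cutoff_gt0 _ _))// cutoff_le.
Qed.

(** Half of the cutoff rate absorbs the growth of [h], the other half the factor 1 + |y|^2. *)
Lemma cutoff_decay eps : 0 < eps -> exists K : R, forall y, cutoff eps y * (1 + dotp y y) <= K.
Proof.
move=> e0; have e2 : 0 < eps / 2 by rewrite divr_gt0.
case: sh => _ /(_ _ e2)[C C0 HC]; exists (C * (1 + 2 / eps)) => y.
have y0 := dotpp_ge0 y; set q := dotp y y in y0 *.
have hC : h y <= C * expR (eps / 2 * q) by apply: le_trans (HC y); exact: ler_norm.
have -> : cutoff eps y * (1 + q) = h y * (expR (- eps * q) * (1 + q)) by rewrite /cutoff mulrA.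
apply: le_trans (_ : C * expR (eps / 2 * q) * (expR (- eps * q) * (1 + q)) <= _).
  by rewrite ler_wpM2r// mulr_ge0 ?expR_ge0// addr_ge0.
rewrite -mulrA ler_wpM2l// mulrA -expRD.
have -> : eps / 2 * q + - eps * q = - (eps / 2 * q) by field.
rewrite expRN ler_pdivrMl ?expR_gt0//.
have h1 := expR_ge1Dx (eps / 2 * q).
have k0 : 0 <= 1 + 2 / eps by rewrite addr_ge0// divr_ge0// ltW.
have := ler_wpM2r k0 h1.
have -> : (1 + eps / 2 * q) * (1 + 2 / eps) = 1 + q + (2 / eps + eps / 2 * q) by field; rewrite gt_eqF.
move=> h2; apply: le_trans h2; rewrite lerDl addr_ge0 ?divr_ge0 ?(ltW e0)//.
by rewrite mulr_ge0// ltW.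
Qed.

Lemma heat_cutoff_le s x eps : 0 < s -> 0 <= eps -> heat (cutoff eps) s x <= heat h s x.
Proof.
move=> s0 e0; have p0 := hpar_gt0 s0; have sc := sgrow_cutoff e0.
rewrite !heatE// ler_wpM2l ?(ltW (hnorm_gt0 _ _))//.
apply: le_Riint; [by apply: gdec_gmom => //; exact: sgrow_cst|by apply: gdec_gmom => //; exact: sgrow_cst|].
by move=> y; rewrite !mul1r ler_wpM2l ?expR_ge0// cutoff_le.
Qed.

(** From exp(-eps q) >= 1 - eps q under the integral. An error linear in [eps] is what makes the
    limit in [hpot_fourpt] explicit. *)
Lemma heat_cutoff_ge s x : 0 < s -> exists2 C : R, 0 <= C &
  forall eps, 0 <= eps -> heat h s x - C * eps <= heat (cutoff eps) s x.
Proof.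
move=> s0; have p0 := hpar_gt0 s0.
have sq := @sgrow_dotpp R d.
exists (hnorm d s * gmom h (hpar s) x (fun y => dotp y y)).
  rewrite mulr_ge0 ?(ltW (hnorm_gt0 _ _))//; apply: Riint_ge0; first exact: gdec_gmom.
  by move=> y; rewrite mulr_ge0 ?dotpp_ge0// mulr_ge0 ?expR_ge0// ltW.
move=> eps e0; have sc := sgrow_cutoff e0.
rewrite !heatE// -mulrA -mulrBr ler_wpM2l ?(ltW (hnorm_gt0 _ _))//.
rewrite [X in _ - X]mulrC -gmomZ// -gmomB//; [|exact: sgrow_cst|exact: sgrowZ].
apply: le_Riint; [|by apply: gdec_gmom => //; exact: sgrow_cst|].
  apply: gdec_gmom => //.
  have -> : (fun y : 'rV[R]_d => 1 - eps * dotp y y) = (fun y => 1 + (- eps) * dotp y y).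
    by apply/funext => y; rewrite mulNr.
  by apply: sgrowD; [exact: sgrow_cst|exact: sgrowZ].
move=> y; rewrite mul1r /cutoff.
have hy := ltW (h_gt0 y); set E := expR (- hpar s * _).
have E0 : 0 <= E by exact: expR_ge0.
rewrite mulrC -mulrA ler_wpM2l// ler_wpM2l//.
by have := expR_ge1Dx (- eps * dotp y y); rewrite mulNr.
Qed.

End Cutoff.

Section HeatFourPoint.
Variables (R : realType) (d : nat) (L : R) (g : 'rV[R]_d -> R).
Hypothesis L0 : 0 < L.
Let h y : R := expR (- g y).
Hypothesis sh : sgrow h.
Hypothesis g_fourpt : fourpt L g.
Local Notation a := (Num.sqrt L).
Let a0 : 0 < a. Proof. by rewrite sqrtr_gt0. Qed.
Let h_gt0 y : 0 < h y. Proof. exact: expR_gt0. Qed.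
Implicit Types (s t eps delta l : R) (m z x y : 'rV[R]_d).

(** The cutoff adds eps|y|^2 to [g], whose four-point difference 2 eps (1 - l^2)|z|^2 is
    nonnegative. *)
Lemma cutoff_init eps m z l : 0 <= eps -> `|l| <= 1 ->
  0 <= - ln (cutoff h eps (m + z)) - ln (cutoff h eps (m - z))
       + ln (cutoff h eps (m + l *: z)) + ln (cutoff h eps (m - l *: z))
       + 2 * psi a (enorm z) - 2 * psi a (l * enorm z).
Proof.
move=> e0 l1.
have lnc y : ln (cutoff h eps y) = - g y - eps * dotp y y.
  by rewrite /cutoff /h -expRD expRK mulNr.
have := g_fourpt m z l1; rewrite !lnc.
have E : dotp (m + z) (m + z) + dotp (m - z) (m - z) - dotp (m + l *: z) (m + l *: z)
   - dotp (m - l *: z) (m - l *: z) = 2 * (1 - l ^+ 2) * dotp z z.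
  by rewrite !dotpE; ring.
have : 0 <= eps * (2 * (1 - l ^+ 2) * dotp z z).
  rewrite mulr_ge0// mulr_ge0 ?dotpp_ge0// mulr_ge0// subr_ge0.
  by rewrite -real_normK ?num_real// exprn_ile1.
rewrite -E; lra.
Qed.

Lemma heat_cutoff_cfg s m z l eps delta : 0 < s -> `|l| <= 1 -> 0 < eps -> 0 < delta ->
  0 <= cfg a delta (heat (cutoff h eps)) s m z l.
Proof.
move=> s0 l1 e0 d0; have sc := sgrow_cutoff sh h_gt0 (ltW e0).
have [K HK] := cutoff_decay sh e0.
have cg := cutoff_gt0 h_gt0 eps.
apply: (@cfg_ge0 R d a delta s (2 * K + 2 * K * mom2 R d * s) (heat (cutoff h eps)) (hgrad (cutoff h eps))
  (hhess (cutoff h eps)) (hlap (cutoff h eps))) => //.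
- by move=> t x; exact: heat_gt0.
- by move=> t x v r t0; exact: heat_line.
- by move=> t x v t0; exact: hgrad_line.
- by move=> t x v t0; exact: sum_hhess.
- by move=> t x t0; exact: heat_time.
- exact: heat_continuous HK.
- by move=> t x ts; apply: heat_decay.
- move=> m' z' l' hl'; rewrite /heat ltxx; exact: cutoff_init (ltW e0) hl'.
- by rewrite (ltW s0) lexx.
Qed.

Lemma ge0_at_zero (k : R -> R) (e l : R) : 0 < e -> is_derive (0 : R) 1 k l ->
  (forall t, 0 < t < e -> 0 <= k t) -> 0 <= k 0.
Proof.
move=> e0 /der_continuous ck H; rewrite leNgt; apply/negP => k0.
have : \forall t \near (0 : R), k t < 0 by exact: (cvgr_lt (k 0) ck).
move=> /nbhs_ballP[r /= r0 Hr].
pose t := Num.min e r / 2.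
have m0 : 0 < Num.min e r by rewrite lt_min e0.
have t0 : 0 < t by rewrite divr_gt0.
have : t < Num.min e r by rewrite ltr_pdivrMr// ltr_pMr// ltr1n.
rewrite lt_min => /andP[te tr].
have /Hr : ball (0 : R) r t by rewrite -ball_normE /= sub0r normrN gtr0_norm.
by rewrite ltNge H// t0.
Qed.

(** Both parameters are set to the same t, and the flows are replaced by affine functions of t
    bounding them on the side that each logarithm requires: from below at the outer points, from
    above at the inner ones. The resulting [k] is continuous at 0, and its value there is the
    claim. *)
Lemma hpot_fourpt s : 0 < s -> fourpt L (hpot h s).
Proof.
move=> s0 m z l l1; rewrite /hpot.
set x1 := m + z; set x2 := m - z; set x3 := m + l *: z; set x4 := m - l *: z.
have u0 x : 0 < heat h s x by exact: heat_gt0.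
have [C1 C10 H1] := heat_cutoff_ge sh h_gt0 x1 s0.
have [C2 C20 H2] := heat_cutoff_ge sh h_gt0 x2 s0.
pose k t := - ln (heat h s x1 + - C1 * t) - ln (heat h s x2 + - C2 * t)
  + ln (heat h s x3 + 1 * t) + ln (heat h s x4 + 1 * t)
  + (2 * psi a (enorm z) - 2 * psi a (l * enorm z)).
have dln c x : is_derive (0 : R) 1 (fun t => ln (heat h s x + c * t)) (c / heat h s x).
  have D := der_add (der_cst (0 : R) (heat h s x)) (der_mulc c (der_id (0 : R))).
  have p0 : 0 < heat h s x + c * 0 by rewrite mulr0 addr0.
  apply: is_derive_eq (@der_ln _ (fun t => heat h s x + c * t) 0 _ p0 D) _.
  by rewrite mulr1 mulr0 add0r addr0.
have dk := der_add (der_add (der_add (der_sub (der_opp (dln (- C1) x1)) (dln (- C2) x2)) (dln 1 x3)) (dln 1 x4))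
  (der_cst (0 : R) (2 * psi a (enorm z) - 2 * psi a (l * enorm z))).
(* Keeps the affine lower bounds at [x1] and [x2] positive. *)
pose e := Num.min (heat h s x1 / (C1 + 1)) (heat h s x2 / (C2 + 1)).
have e0 : 0 < e by rewrite lt_min !divr_gt0// ltr_wpDl.
have kpos t : 0 < t < e -> 0 <= k t.
  move=> /andP[t0]; rewrite lt_min ltr_pdivlMr ?ltr_wpDl// ltr_pdivlMr ?ltr_wpDl// => /andP[t1 t2].
  have := heat_cutoff_cfg m z s0 l1 t0 t0; rewrite /cfg -/x1 -/x2 -/x3 -/x4 /k.
  have sc := sgrow_cutoff sh h_gt0 (ltW t0).
  have cp x : 0 < heat (cutoff h t) s x by apply: heat_gt0 => // y; exact: cutoff_gt0.
  have q1 : ln (heat h s x1 + - C1 * t) <= ln (heat (cutoff h t) s x1).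
    rewrite ler_ln ?posrE//; first by rewrite mulNr H1// ltW.
    by move: t1; rewrite mulrDr mulr1 (mulrC t); lra.
  have q2 : ln (heat h s x2 + - C2 * t) <= ln (heat (cutoff h t) s x2).
    rewrite ler_ln ?posrE//; first by rewrite mulNr H2// ltW.
    by move: t2; rewrite mulrDr mulr1 (mulrC t); lra.
  have q3 x : ln (heat (cutoff h t) s x + t) <= ln (heat h s x + 1 * t).
    rewrite mul1r ler_ln ?posrE ?addr_gt0// lerD2r.
    exact: (heat_cutoff_le sh h_gt0 x s0 (ltW t0)).
  have := q3 x3; have := q3 x4; lra.
have := ge0_at_zero e0 dk kpos.
rewrite /= !mulr0 !addr0; lra.
Qed.

End HeatFourPoint.

Section Theorem3.
Variables (R : realType) (d : nat) (L : R).
Hypothesis L0 : 0 < L.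
Local Notation a := (Num.sqrt L).

Lemma sgrow_exp_potential (g : 'rV[R]_d -> R) (b : 'rV[R]_d) (k c0 : R) : continuous g ->
  0 <= k -> (forall y, c0 + dotp b y - k * enorm y <= g y) -> sgrow (fun y => expR (- g y)).
Proof.
move=> cg k0 H; split.
  by apply: (continuous_comp_real (@continuous_expR R)); exact: continuous_opp.
move=> c c_gt0; have c2 : 0 < c / 2 by rewrite divr_gt0.
exists (expR (- c0 + (4 * (c / 2))^-1 * dotp (- b) (- b) + (4 * (c / 2))^-1 * k ^+ 2)); first exact: expR_ge0.
move=> y; rewrite ger0_norm ?expR_ge0// -expRD ler_expR.
(* The budget c|y|^2 is split in two: one half for the linear form, one for the norm term. *)
have h1 := dotp_young (- b) y c2; rewrite [dotp (- b) y]dotpNl in h1.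
have h2 : k * enorm y <= c / 2 * dotp y y + (4 * (c / 2))^-1 * k ^+ 2.
  rewrite -sqr_enorm; move: (enorm y) => p.
  have : 0 <= (4 * (c / 2))^-1 * (2 * (c / 2) * p - k) ^+ 2.
    by rewrite mulr_ge0 ?sqr_ge0// invr_ge0 mulr_ge0// ltW.
  have -> : (4 * (c / 2))^-1 * (2 * (c / 2) * p - k) ^+ 2 =
    c / 2 * p ^+ 2 + (4 * (c / 2))^-1 * k ^+ 2 - k * p by field; rewrite gt_eqF.
  by rewrite subr_ge0.
have := H y; lra.
Qed.

Lemma UTg_hpot (g : 'rV[R]_d -> R) (t T : R) : sgrow (fun y => expR (- g y)) -> t < T ->
  UTg T g t = hpot (fun y => expR (- g y)) (T - t).
Proof.
move=> sh tT; have s0 : 0 < T - t by rewrite subr_gt0.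
apply/funext => x; rewrite /UTg tT /hpot heatE//; congr (- ln (_ * _)).
  (* For a positive base [powR] unfolds to the exponential that defines [hnorm]. *)
  rewrite /powR gt_eqF ?mulr_gt0 ?pi_gt0//.
rewrite /gmom -[RHS]/(fine (Riint _)%:E) -EFin_Riint; last first.
  by apply: gdec_gmom => //; [exact: hpar_gt0|exact: sgrow_cst].
congr fine; apply: eq_iint => y; congr EFin.
rewrite [RHS]mul1r -[RHS]expRD; congr expR; congr (_ - _).
by rewrite sqr_enorm mulNr [RHS]mulNr [in RHS]mulrC.
Qed.

End Theorem3.

Theorem theorem3 (R : realType) (d : nat) (L : R) (hL : 0 < L)
  (t T : R) (ht : 0 <= t) (htT : t <= T) (g : 'rV[R]_d -> R) :
  FL L g -> FL L (UTg T g t).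
Proof.
move=> FLg; move: (htT); rewrite le_eqVlt => /orP[/eqP tT|tT].
  by rewrite (_ : UTg T g t = g)//; apply/funext => x; rewrite /UTg tT ltxx.
have s0 : 0 < T - t by rewrite subr_gt0.
have [[dg _] kg] := FLg.
have g_line (x v : 'rV[R]_d) (r : R) :
    is_derive r 1 (fun r => g (x + r *: v)) (dotp (grad g (x + r *: v)) v).
  exact: grad_line (dg _).
have g2 : twopt L (grad g) := (kappa_twoptP L (grad g)).1 kg.
have sh : sgrow (fun y => expR (- g y)).
  have cg : continuous g by move=> x; exact: differentiable_continuous.
  have a0 : 0 <= 2 * Num.sqrt L by rewrite mulr_ge0 ?sqrtr_ge0.
  exact: (sgrow_exp_potential cg a0 (twopt_lower_bound hL g_line g2)).
have h_gt0 y : 0 < expR (- g y) by exact: expR_gt0.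
rewrite (UTg_hpot sh tT); split; first exact: C1_hpot.
have gE := grad_hpot sh h_gt0 s0.
have U_line (x v : 'rV[R]_d) (r : R) := hpot_line sh h_gt0 x v r s0.
apply: (kappa_twoptP L (grad (hpot (fun y => expR (- g y)) (T - t)))).2.
rewrite gE; apply: (fourpt_twopt U_line).
exact: (hpot_fourpt hL sh (twopt_fourpt g_line g2) s0).
Qed.
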